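(* Let $p\geq 3$ be a prime number. Then $c_p(A,B)\equiv \ell_p(A,B)\pmod{p}$, i.e. $c_p(A,B)-\ell_p(A,B)\in p\,\mathbb{Z}[A,B]$.
   Context: Let $A,B$ be indeterminates. Define polynomials $\psi_m$ by $\psi_0=0$, $\psi_1=1$, $\psi_2=2y$, $\psi_3=3x^4+6Ax^2+12Bx-A^2$, $\psi_4=2y\left(2x^6+10Ax^4+40Bx^3-10A^2x^2-8ABx-2(A^3+8B^2)\right)$, and for $m\ge 2$ recursively $\psi_{2m+1}=\psi_{m+2}\psi_m^3-\psi_{m-1}\psi_{m+1}^3$ and $2y\,\psi_{2m}=\psi_{m-1}^2\psi_m\psi_{m+2}-\psi_{m-2}\psi_m\psi_{m+1}^2$, where every expression is reduced using the relation $y^2=x^3+Ax+B$. For odd $m$, $\psi_m$ lies in $\mathbb{Z}[x,A,B]$; write $\psi_p(x,A,B)\in\mathbb{Z}[x,A,B]$ for the $p$-th one (the $p$-th division polynomial of $y^2=x^3+Ax+B$). Let $\ell_p(A,B)\in\mathbb{Z}[A,B]$ be the coefficient of $x^{\frac12 p(p-1)}$ in $\psi_p(x,A,B)$, viewed as a polynomial in $x$. Let $c_p(A,B)\in\mathbb{Z}[A,B]$ be the coefficient of $x^{p-1}$ in $(x^3+Ax+B)^{\frac12(p-1)}$. *)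

(* Defs.v *)
From HB Require Import structures.
From mathcomp Require Import all_boot all_order all_algebra.
From mathcomp Require Import mpoly.
From mathcomp Require Import zify ring.

Set Implicit Arguments.
Unset Strict Implicit.
Unset Printing Implicit Defensive.

Import GRing.Theory.
Local Open Scope ring_scope.

Notation ZAB := {mpoly int[2]}.

Definition indA : ZAB := 'X_(ord0 : 'I_2).
Definition indB : ZAB := 'X_(ord_max : 'I_2).

Definition cubic : {poly ZAB} := 'X^3 + indA *: 'X + indB%:P.

(* Monic of size 3 in the outer variable y, so that [{poly %/ weierstrass}] is
   the genuine quotient Z[A,B][x][y]/(y^2 - (x^3 + Ax + B)), whose elements are
   the remainders u(x) + v(x) y. *)
Definition weierstrass : {poly {poly ZAB}} := 'X^2 - cubic%:P.

Notation curve_ring := {poly %/ weierstrass}.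

Definition cA : curve_ring := qpolyC weierstrass indA%:P.
Definition cB : curve_ring := qpolyC weierstrass indB%:P.
Definition cx : curve_ring := qpolyC weierstrass 'X.
Definition cy : curve_ring := 'qX.

Record is_division_polynomials (psi : nat -> curve_ring) : Prop :=
  IsDivisionPolynomials {
  dpoly0 : psi 0%N = 0;
  dpoly1 : psi 1%N = 1;
  dpoly2 : psi 2%N = 2 * cy;
  dpoly3 : psi 3%N =
    3 * cx ^+ 4 + 6 * cA * cx ^+ 2 + 12 * cB * cx - cA ^+ 2;
  dpoly4 : psi 4%N =
    2 * cy * (2 * cx ^+ 6 + 10 * cA * cx ^+ 4 + 40 * cB * cx ^+ 3
              - 10 * cA ^+ 2 * cx ^+ 2 - 8 * cA * cB * cx
              - 2 * (cA ^+ 3 + 8 * cB ^+ 2));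
  dpoly_odd : forall m, (2 <= m)%N ->
    psi (2 * m + 1)%N =
      psi (m + 2)%N * psi m ^+ 3 - psi (m - 1)%N * psi (m + 1)%N ^+ 3;
  dpoly_even : forall m, (2 <= m)%N ->
    2 * cy * psi (2 * m)%N =
      psi (m - 1)%N ^+ 2 * psi m * psi (m + 2)%N
      - psi (m - 2)%N * psi m * psi (m + 1)%N ^+ 2
}.

Lemma size_cubic : size cubic = 4%N.
Proof.
rewrite /cubic -addrA size_polyDl size_polyXn //.
rewrite (leq_ltn_trans (size_polyD _ _)) // gtn_max.
rewrite (leq_ltn_trans (size_scale_leq _ _)) ?size_polyX //=.
by rewrite (leq_ltn_trans (size_polyC_leq1 _)).
Qed.

Lemma size_weierstrass : size weierstrass = 3%N.
Proof.
by rewrite /weierstrass size_polyDl size_polyXn // size_polyN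
           (leq_ltn_trans (size_polyC_leq1 _)).
Qed.

Lemma mk_monic_weierstrass : mk_monic weierstrass = weierstrass.
Proof.
rewrite /mk_monic size_weierstrass /= ifT //.
rewrite monicE /weierstrass lead_coefDl ?lead_coefXn //.
by rewrite size_polyXn size_polyN (leq_ltn_trans (size_polyC_leq1 _)).
Qed.

Lemma cyE : cy = 'X :> {poly {poly ZAB}}.
Proof.
by rewrite /cy in_qpoly_small // mk_monic_weierstrass size_weierstrass size_polyX.
Qed.

Lemma cy_sqr : cy ^+ 2 = qpolyC weierstrass cubic.
Proof.
have h0 : in_qpoly weierstrass weierstrass = 0.
  apply: val_inj; rewrite /= -[X in Pdiv.Ring.rmodp X _]mk_monic_weierstrass.
  exact: Pdiv.RingMonic.rmodpp (monic_mk_monic _).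
have {1}-> : cy ^+ 2 = in_qpoly weierstrass (weierstrass + cubic%:P).
  by rewrite /weierstrass subrK rmorphXn.
rewrite rmorphD /= h0 add0r; apply: val_inj => /=.
rewrite Pdiv.Ring.rmodp_small // mk_monic_weierstrass size_weierstrass.
by rewrite (leq_ltn_trans (size_polyC_leq1 _)).
Qed.

Lemma cubic_eq : qpolyC weierstrass cubic = cx ^+ 3 + cA * cx + cB.
Proof. by rewrite /cubic !rmorphD rmorphXn -mul_polyC rmorphM. Qed.

Lemma two_neq0 : (2 : {poly ZAB}) != 0.
Proof.
rewrite -polyC_natr polyC_eq0 -(mpolyC_nat 2 _ 2%N).
by rewrite mpolyC_eq0.
Qed.

Lemma qpolyC_2 : qpolyC weierstrass 2 = 2.
Proof. exact: (rmorph_nat (qpolyC weierstrass) 2). Qed.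

Lemma qpolyC_mul (a : {poly ZAB}) (w : curve_ring) :
  qpolyC weierstrass a * w = a *: w.
Proof.
apply: val_inj; rewrite /= mul_polyC.
by rewrite Pdiv.Ring.rmodp_small // (leq_ltn_trans (size_scale_leq _ _)) //
           size_mk_monic.
Qed.

Lemma cubic_neq0 : cubic != 0.
Proof. by rewrite -size_poly_eq0 size_cubic. Qed.

Lemma two_cubic_neq0 : 2 * cubic != 0.
Proof. exact: mulf_neq0 two_neq0 cubic_neq0. Qed.

Lemma mul2_sqr (S : comNzRingType) (c w : S) :
  2 * c * w = 0 -> 2 * c ^+ 2 * w = 0.
Proof. by move=> e; rewrite -(mulr0 c) -e; ring. Qed.

Lemma cy2_inj (u v : curve_ring) : 2 * cy * u = 2 * cy * v -> u = v.
Proof.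
move/eqP; rewrite -subr_eq0 -mulrBr => /eqP/mul2_sqr.
rewrite cy_sqr -qpolyC_2 -qpolyCM qpolyC_mul => e.
apply/eqP; rewrite -subr_eq0; move: (u - v) e => w /(congr1 val) /= e.
apply/eqP/val_inj => /=; apply/eqP; move/eqP: e.
by rewrite -mul_polyC mulf_eq0 polyC_eq0 (negPf two_cubic_neq0).
Qed.

(* Existence: since y^2 = F, the recursion restricts to the sequence equal to
   psi_n for n odd and to psi_n / (2y) for n even, which lives in Z[x,A,B] and
   involves no division. *)
Section Construction.
Variables (P T : comNzRingType) (phi : {rmorphism P -> T}).
Variables (a b x F : P) (y : T).
Hypothesis y_sqr : y ^+ 2 = phi F.

Definition dpoly_step (g : nat -> P) (m : nat) (is_odd : bool) : P :=
  if is_odd then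
    if odd m then
      g (m + 2)%N * g m ^+ 3 - 16 * F ^+ 2 * g (m - 1)%N * g (m + 1)%N ^+ 3
    else
      16 * F ^+ 2 * g (m + 2)%N * g m ^+ 3 - g (m - 1)%N * g (m + 1)%N ^+ 3
  else
    g m * (g (m + 2)%N * g (m - 1)%N ^+ 2 - g (m - 2)%N * g (m + 1)%N ^+ 2).

(* [k] is fuel. *)
Fixpoint reduced_dpoly_rec (k n : nat) : P :=
  if k is k'.+1 then
    match n with
    | 0 => 0
    | 1 => 1
    | 2 => 1
    | 3 => 3 * x ^+ 4 + 6 * a * x ^+ 2 + 12 * b * x - a ^+ 2
    | 4 => 2 * x ^+ 6 + 10 * a * x ^+ 4 + 40 * b * x ^+ 3
             - 10 * a ^+ 2 * x ^+ 2 - 8 * a * b * x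
             - 2 * (a ^+ 3 + 8 * b ^+ 2)
    | n'.+4.+1 => dpoly_step (reduced_dpoly_rec k') n./2 (odd n)
    end
  else 0.

Definition reduced_dpoly n := reduced_dpoly_rec n.+1 n.

Lemma reduced_dpoly_recS k n : (4 < n)%N ->
  reduced_dpoly_rec k.+1 n = dpoly_step (reduced_dpoly_rec k) n./2 (odd n).
Proof. by case: n => [|[|[|[|[|n]]]]]. Qed.

Lemma dpoly_step_eq g h m o :
  {in [:: m - 2; m - 1; m; m + 1; m + 2]%N, g =1 h} ->
  dpoly_step g m o = dpoly_step h m o.
Proof. by move=> e; rewrite /dpoly_step !e // !inE eqxx ?orbT. Qed.

Lemma reduced_dpoly_recE k n :
  (n < k)%N -> reduced_dpoly_rec k n = reduced_dpoly n.
Proof.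
suff H : forall N k l n, (n <= N)%N -> (n < k)%N -> (n < l)%N ->
    reduced_dpoly_rec k n = reduced_dpoly_rec l n.
  by move=> nk; apply: (H n).
elim=> [|N IH] {}k {}l {}n nN.
  by case: k => // k _; case: l => // l _; case: n nN.
case: k => // k nk; case: l => // l nl.
case: (ltnP 4 n) => [n4|]; last by case: n {nN nk nl} => [|[|[|[|[|]]]]].
rewrite !reduced_dpoly_recS //; apply: dpoly_step_eq => i.
by rewrite !inE => Hi; apply: IH; lia.
Qed.

Lemma reduced_dpolyS n : (4 < n)%N ->
  reduced_dpoly n = dpoly_step reduced_dpoly n./2 (odd n).
Proof.
move=> n4; rewrite [LHS]reduced_dpoly_recS //; apply: dpoly_step_eq => i.
by rewrite !inE => Hi; apply: reduced_dpoly_recE; lia.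
Qed.

Lemma reduced_dpoly_odd m : (2 <= m)%N ->
  reduced_dpoly (2 * m + 1)%N = dpoly_step reduced_dpoly m true.
Proof.
move=> m2; rewrite reduced_dpolyS; last lia.
by have [-> ->] : (2 * m + 1)./2 = m /\ odd (2 * m + 1) by lia.
Qed.

Lemma reduced_dpoly_even m : (3 <= m)%N ->
  reduced_dpoly (2 * m)%N = dpoly_step reduced_dpoly m false.
Proof.
move=> m2; rewrite reduced_dpolyS; last lia.
by have [-> ->] : (2 * m)./2 = m /\ odd (2 * m) = false by lia.
Qed.

Definition lift_dpoly n : T :=
  (if odd n then 1 else 2 * y) * phi (reduced_dpoly n).

Lemma lift_dpoly0 : lift_dpoly 0 = 0.
Proof. by rewrite /lift_dpoly rmorph0 mulr0. Qed.

Lemma lift_dpoly1 : lift_dpoly 1 = 1.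
Proof. by rewrite /lift_dpoly rmorph1 mulr1. Qed.

Lemma lift_dpoly2 : lift_dpoly 2 = 2 * y.
Proof. by rewrite /lift_dpoly rmorph1 mulr1. Qed.

Lemma lift_dpoly3 : lift_dpoly 3 =
  3 * phi x ^+ 4 + 6 * phi a * phi x ^+ 2 + 12 * phi b * phi x - phi a ^+ 2.
Proof.
by rewrite /lift_dpoly mul1r /reduced_dpoly /=; ring.
Qed.

Lemma lift_dpoly4 : lift_dpoly 4 =
  2 * y * (2 * phi x ^+ 6 + 10 * phi a * phi x ^+ 4 + 40 * phi b * phi x ^+ 3
           - 10 * phi a ^+ 2 * phi x ^+ 2 - 8 * phi a * phi b * phi x
           - 2 * (phi a ^+ 3 + 8 * phi b ^+ 2)).
Proof.
by rewrite /lift_dpoly /reduced_dpoly /=; ring.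
Qed.

Lemma lift_dpoly_odd m : (2 <= m)%N ->
  lift_dpoly (2 * m + 1)%N =
    lift_dpoly (m + 2)%N * lift_dpoly m ^+ 3
    - lift_dpoly (m - 1)%N * lift_dpoly (m + 1)%N ^+ 3.
Proof.
move=> m2; rewrite /lift_dpoly reduced_dpoly_odd // /dpoly_step.
have -> : odd (2 * m + 1) by lia.
have -> : odd (m + 2) = odd m by lia.
have -> : odd (m - 1) = ~~ odd m by lia.
have -> : odd (m + 1) = ~~ odd m by lia.
have F2 u v : phi (16 * F ^+ 2 * u * v ^+ 3) = 16 * y ^+ 4 * phi u * phi v ^+ 3.
  by transitivity (16 * phi F ^+ 2 * phi u * phi v ^+ 3);
     [ring | rewrite -y_sqr; ring].
by case: (odd m); rewrite /= rmorphB F2; ring.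
Qed.

Lemma lift_dpoly_even m : (2 <= m)%N ->
  2 * y * lift_dpoly (2 * m)%N =
    lift_dpoly (m - 1)%N ^+ 2 * lift_dpoly m * lift_dpoly (m + 2)%N
    - lift_dpoly (m - 2)%N * lift_dpoly m * lift_dpoly (m + 1)%N ^+ 2.
Proof.
rewrite leq_eqVlt => /orP[/eqP <-|m3].
  by rewrite lift_dpoly0 lift_dpoly1 lift_dpoly2; ring.
rewrite /lift_dpoly reduced_dpoly_even // /dpoly_step.
have -> : odd (2 * m) = false by lia.
have -> : odd (m + 2) = odd m by lia.
have -> : odd (m - 1) = ~~ odd m by lia.
have -> : odd (m + 1) = ~~ odd m by lia.
have -> : odd (m - 2) = odd m by lia.
by case: (odd m) => /=; ring.
Qed.

End Construction.

Definition curve_dpoly : nat -> curve_ring :=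
  lift_dpoly (qpolyC weierstrass) indA%:P indB%:P 'X cubic cy.

Lemma curve_dpolyP : is_division_polynomials curve_dpoly.
Proof.
split.
- exact: lift_dpoly0.
- exact: lift_dpoly1.
- exact: lift_dpoly2.
- exact: lift_dpoly3.
- exact: lift_dpoly4.
- exact: (lift_dpoly_odd _ _ _ cy_sqr).
- exact: lift_dpoly_even.
Qed.

Lemma division_polynomials_exist : {psi | is_division_polynomials psi}.
Proof. by exists curve_dpoly; exact: curve_dpolyP. Qed.

Lemma division_polynomials_uniq psi phi :
  is_division_polynomials psi -> is_division_polynomials phi -> psi =1 phi.
Proof.
move=> P Q n; elim/ltn_ind: n => n IH.
case: (ltnP n 5) => [|n5].
  case: n {IH} => [|[|[|[|[|]]]]] // _.
  - by rewrite (dpoly0 P) (dpoly0 Q).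
  - by rewrite (dpoly1 P) (dpoly1 Q).
  - by rewrite (dpoly2 P) (dpoly2 Q).
  - by rewrite (dpoly3 P) (dpoly3 Q).
  - by rewrite (dpoly4 P) (dpoly4 Q).
have [o|o] := boolP (odd n).
  have e : n = (2 * n./2 + 1)%N by lia.
  rewrite e (dpoly_odd P) ?(dpoly_odd Q); try lia.
  by rewrite !IH //; lia.
have e : n = (2 * n./2)%N by lia.
apply: cy2_inj; rewrite e (dpoly_even P) ?(dpoly_even Q); try lia.
by rewrite !IH //; lia.
Qed.

Definition psi : nat -> curve_ring := sval division_polynomials_exist.

Lemma psiP : is_division_polynomials psi.
Proof. exact: svalP division_polynomials_exist. Qed.

(* The y-free part of psi_m; for odd m it is all of psi_m, by
   [division_polynomial_odd]. *)
Definition division_polynomial (m : nat) : {poly ZAB} :=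
  (psi m : {poly {poly ZAB}})`_0.

Lemma division_polynomial_odd m :
  odd m -> psi m = qpolyC weierstrass (division_polynomial m).
Proof.
move=> o; rewrite /division_polynomial.
rewrite (division_polynomials_uniq psiP curve_dpolyP) /curve_dpoly /lift_dpoly o mul1r.
by rewrite qpolyCE coefC.
Qed.

Definition ell (p : nat) : ZAB :=
  (division_polynomial p)`_((p * (p - 1)) %/ 2).

Definition hasse_coef (p : nat) : ZAB :=
  (cubic ^+ ((p - 1) %/ 2))`_(p - 1).

(* Main.v *)
Require Import Defs.
From mathcomp Require Import all_boot all_order all_algebra.
From mathcomp Require Import mpoly.
From mathcomp Require Import zify ring.
Import GRing.Theory.
Local Open Scope ring_scope.

Set Implicit Arguments.
Unset Strict Implicit.
Unset Printing Implicit Defensive.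

(* Let Q be the generic point of the curve, psi = psi_p and x([p]Q) = phi / psi^2.
   Two differential equations are extracted from the recursion:
   the second logarithmic derivative of psi_n along the invariant derivation
   2y d/dx is n^2 (x - x([n]Q)), and the derivative of x([n]Q) is n times
   2 y([n]Q).  For n = p they read
     4f (psi psi'' - psi'^2) + 2f' psi psi' = p^2 (x psi^2 - phi),
     f w^2 = phi^3 + A phi psi^4 + B psi^6   with  p w = phi' psi - 2 phi psi',
   where f = x^3 + A x + B.  Modulo p the first one forces the degree of psi to
   be a multiple of p, hence at most p(p-1)/2; so psi is divisible by p above
   that degree, and w is, in its leading (p-1)/2 terms, -2 x^(p^2) psi' / p:
   it is monic, and l_p is its coefficient (p-1)/2 places below the top.  Modulo
   p and to that relative order, the second equation says that w is x^(3p^2/2)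
   f^(-1/2).  So is a power of x times f^((p-1)/2), because f^p is x^(3p) to high
   order; comparing coefficients gives l_p = c_p. *)

(** * The ratios psi_(n-1) psi_(n+1) / psi_n ^ 2 and their derivatives *)

Section EllipticSequence.
Variables (K : fieldType) (al T : K) (G : nat -> K).
Hypothesis al_neq0 : al != 0.
Hypothesis G_neq0 : forall n, (0 < n)%N -> G n != 0.
Hypotheses (G0 : G 0 = 0) (G1 : G 1 = 1) (G2 : G 2 = 1).
Hypothesis G4 : G 4 = T * G 3 - al ^+ 2.
Hypothesis G_odd : forall m, (2 <= m)%N -> G (2 * m + 1)%N =
  if odd m then G (m + 2)%N * G m ^+ 3 - al ^+ 2 * G (m - 1)%N * G (m + 1)%N ^+ 3
  else al ^+ 2 * G (m + 2)%N * G m ^+ 3 - G (m - 1)%N * G (m + 1)%N ^+ 3.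
Hypothesis G_even : forall m, (3 <= m)%N -> G (2 * m)%N =
  G m * (G (m + 2)%N * G (m - 1)%N ^+ 2 - G (m - 2)%N * G (m + 1)%N ^+ 2).

Local Notation be := (G 3).

(* Here psi_n is G n for odd n and 2 y G n for even n, with al = 4 y ^ 2, so
   that dratio n = psi_(n-1) psi_(n+1) / psi_n ^ 2 = x(Q) - x([n]Q) for the
   generic point Q of the curve. *)
Definition dratio n :=
  (if odd n then al else al^-1) * G n.-1 * G n.+1 / G n ^+ 2.
Local Notation e := dratio.

Lemma dratio1 : e 1 = 0.
Proof. by rewrite /dratio /= G0 mulr0 !mul0r. Qed.

Lemma dratio2 : e 2 = be / al.
Proof. by rewrite /dratio /= G1 G2 expr1n divr1 mulr1 mulrC. Qed.

Lemma dratio_neq0 n : (2 <= n)%N -> e n != 0.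
Proof.
move=> n2; rewrite /dratio !mulf_neq0 ?invr_eq0 ?expf_neq0 //; try (apply: G_neq0; lia).
by case: odd; rewrite ?invr_eq0.
Qed.

(** Dividing the odd recursion by psi_m^2 psi_(m+1)^2 turns its two terms into two ratios. The
    factor [al] is the 4y^2 of whichever of psi_m, psi_(m+1) has even index. *)
Lemma dratio_diff1 m : (0 < m)%N ->
  e m.+1 - e m = G (2 * m + 1)%N / (al * G m ^+ 2 * G m.+1 ^+ 2).
Proof.
case: m => // -[_|m _]; first by rewrite dratio1 dratio2 G1 G2; field.
rewrite G_odd // /dratio !addn1 addn2 subn1 /= negbK.
have := (G_neq0 (ltn0Sn m), G_neq0 (ltn0Sn m.+1), G_neq0 (ltn0Sn m.+2)).
by case=> -[h1 h2] h3; case: (odd m) => /=; field; rewrite ?al_neq0 ?h1 ?h2 ?h3.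
Qed.

Lemma dratio_diff2 m : (2 <= m)%N ->
  e m.+1 - e m.-1 = (if odd m then al^-1 else al) * G (2 * m)%N / (G m.-1 ^+ 2 * G m.+1 ^+ 2).
Proof.
have h3 := G_neq0 (isT : 0 < 3)%N.
case: m => // -[//|] -[_|m _] /=.
  rewrite dratio1 /dratio /= G1 G2; by field.
rewrite G_even // /dratio !addn1 addn2 subn1 subn2 /= !negbK.
have := (G_neq0 (ltn0Sn m), G_neq0 (ltn0Sn m.+1), G_neq0 (ltn0Sn m.+2), G_neq0 (ltn0Sn m.+3)).
by case=> -[[h0 h1] h2] h4; case: (odd m) => /=; field; rewrite ?al_neq0 ?h0 ?h1 ?h2 ?h3 ?h4.
Qed.

Lemma dratio_neq1 m : (0 < m)%N -> e m.+1 - e m != 0.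
Proof.
move=> m0; rewrite dratio_diff1 // !mulf_neq0 ?invr_eq0 ?mulf_neq0 ?expf_neq0 //;
  apply: G_neq0; lia.
Qed.

Lemma dratio_neq2 m : (2 <= m)%N -> e m.+1 - e m.-1 != 0.
Proof.
move=> m0; rewrite dratio_diff2 // !mulf_neq0 ?invr_eq0 ?mulf_neq0 ?expf_neq0 //;
  try (apply: G_neq0; lia).
by case: odd; rewrite ?invr_eq0.
Qed.

(** In psi_(2m-1) psi_(2m+1) / psi_(2m)^2 each factor is a difference of two ratios up to squares of
    psi_(m-1), psi_m, psi_(m+1). Index 2m+1 is treated likewise. *)
Lemma dratio_double m : (2 <= m)%N ->
  e (2 * m)%N = al * (e m.+1 - e m) * (e m - e m.-1)
    / (e m ^+ 2 * (e m.+1 - e m.-1) ^+ 2).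
Proof.
case: m => // -[//|m] _; rewrite dratio_diff2 // !dratio_diff1 //=.
have -> : e (2 * m.+2) = al^-1 * G (2 * m.+1 + 1) * G (2 * m.+2 + 1) / G (2 * m.+2) ^+ 2.
  rewrite /dratio; have -> : odd (2 * m.+2) = false by lia.
  by congr (_ * G _ * G _ / _); lia.
rewrite /dratio /= negbK.
have h0 := G_neq0 (ltn0Sn m); have h1 := G_neq0 (ltn0Sn m.+1); have h2 := G_neq0 (ltn0Sn m.+2).
have hd : G (2 * m.+2) != 0 by apply: G_neq0; lia.
by case: (odd m) => /=; field; rewrite ?al_neq0 ?h0 ?h1 ?h2 ?hd.
Qed.

Lemma dratio_doubleS m : (2 <= m)%N ->
  e (2 * m).+1 = e m.+1 ^+ 2 * e m ^+ 2 * (e m.+2 - e m) * (e m.+1 - e m.-1)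
    / (al * (e m.+1 - e m) ^+ 2).
Proof.
case: m => // -[//|m] _.
have := dratio_diff2 (isT : 2 <= m.+3)%N; rewrite [m.+3.-1]/= => ->.
rewrite dratio_diff2 // !dratio_diff1 //=.
have -> : e (2 * m.+2).+1 = al * G (2 * m.+2) * G (2 * m.+3) / G (2 * m.+2 + 1) ^+ 2.
  rewrite /dratio; have -> : odd (2 * m.+2).+1 by lia.
  by rewrite addn1; congr (_ * G _ * G _ / _); lia.
rewrite /dratio /= !negbK.
have h0 := G_neq0 (ltn0Sn m); have h1 := G_neq0 (ltn0Sn m.+1); have h2 := G_neq0 (ltn0Sn m.+2).
have h3 := G_neq0 (ltn0Sn m.+3).
have hd : G (2 * m.+2 + 1) != 0 by apply: G_neq0; lia.
by case: (odd m) => /=; field; rewrite ?al_neq0 ?h0 ?h1 ?h2 ?h3 ?hd.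
Qed.

(* Relates a = x(Q) - x(R) and b = x(Q) - x(Q + R) for an arbitrary point R. *)
Definition addrel (a b : K) :=
  a ^+ 2 * b ^+ 2 - T * a * b + al * (a + b) - be.

Lemma addrelC a b : addrel a b = addrel b a.
Proof. by rewrite /addrel; ring. Qed.

(** The relation is quadratic in its second argument, so the sum of the roots gives one root from
    the other. For a = [e n] the roots are the two neighbouring ratios. *)
Lemma addrel_roots a b c : a != 0 -> b - c != 0 ->
  addrel a b = 0 -> addrel a c = 0 -> c = (T * a - al) / a ^+ 2 - b.
Proof.
move=> a0 bc hb hc.
have : (b - c) * (a ^+ 2 * (b + c) - (T * a - al)) = 0.
  by rewrite -[RHS](subrr 0) -{1}hb -hc /addrel; ring.
move/eqP; rewrite mulf_eq0 (negPf bc) subr_eq0 => /eqP h.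
by rewrite -h; field.
Qed.

(* a = e_m, b = e_(m+1); then c = e_(m-1), d = e_(m+2), and the two arguments of
   the conclusion are e_(2m) and e_(2m+1). *)
Lemma addrel_double a b c d : a != 0 -> b != 0 -> b - a != 0 -> b - c != 0 ->
  addrel a b = 0 ->
  c = (T * a - al) / a ^+ 2 - b -> d = (T * b - al) / b ^+ 2 - a ->
  addrel (al * (b - a) * (a - c) / (a ^+ 2 * (b - c) ^+ 2))
    (b ^+ 2 * a ^+ 2 * (d - a) * (b - c) / (al * (b - a) ^+ 2)) = 0.
Proof.
move=> a0 b0 ba bc /eqP; rewrite subr_eq0 => /eqP hbe hc hd.
(* After c and d are substituted and [be] is eliminated through the relation, only a rational
   identity in a, b, [T], [al] is left. *)
have hu : a ^+ 2 * (b - c) = 2 * a ^+ 2 * b - T * a + al by rewrite hc; field.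
have u0 : 2 * a ^+ 2 * b - T * a + al != 0 by rewrite -hu mulf_neq0 ?expf_neq0.
have -> : al * (b - a) * (a - c) / (a ^+ 2 * (b - c) ^+ 2) =
  al * (b - a) * (a ^+ 3 - T * a + al + a ^+ 2 * b) / (2 * a ^+ 2 * b - T * a + al) ^+ 2.
  rewrite -hu; have -> : a ^+ 3 - T * a + al + a ^+ 2 * b = a ^+ 2 * (a - c).
    by rewrite hc; field.
  by field; rewrite bc a0.
have -> : b ^+ 2 * a ^+ 2 * (d - a) * (b - c) / (al * (b - a) ^+ 2) =
  (2 * a ^+ 2 * b - T * a + al) * (T * b - al - 2 * a * b ^+ 2) / (al * (b - a) ^+ 2).
  rewrite -hu; have -> : T * b - al - 2 * a * b ^+ 2 = b ^+ 2 * (d - a).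
    by rewrite hd; field.
  by field; rewrite ba al_neq0.
rewrite /addrel -hbe; field.
by rewrite ?u0 ?ba ?al_neq0.
Qed.

(** Strong induction by halving the index: the relation at n follows from the one at n./2, whose
    outer neighbours are recovered as second roots. *)
Lemma addrel_dratio n : (0 < n)%N -> addrel (e n) (e n.+1) = 0.
Proof.
elim/ltn_ind: n => n IH n0.
have h3 := G_neq0 (isT : 0 < 3)%N.
have h4 := G_neq0 (isT : 0 < 4)%N; rewrite G4 in h4.
case: (ltnP n 4) => [n4|n4].
  case: n {IH} n0 n4 => [//|[|[|[|//]]]] _ _.
  - by rewrite dratio1 dratio2 /addrel; field.
  - by rewrite dratio2 /dratio /= G2 G4 /addrel; field; rewrite ?al_neq0 ?h3.
  - rewrite /dratio /= G2 G4; have := G_odd (isT : 2 <= 2)%N.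
    rewrite /= muln2 => ->; rewrite /= G1 G2 G4 /addrel; field.
    by rewrite ?al_neq0 ?h3 ?h4.
have J k : (0 < k < n)%N -> addrel (e k) (e k.+1) = 0.
  by case/andP=> k0 kn; apply: IH.
have V k : (0 < k)%N -> (k.+1 < n)%N ->
    e k = (T * e k.+1 - al) / e k.+1 ^+ 2 - e k.+2
    /\ e k.+2 = (T * e k.+1 - al) / e k.+1 ^+ 2 - e k.
  move=> k0 kn; have e0 : e k.+1 != 0 by apply: dratio_neq0.
  have d0 : e k.+2 - e k != 0 by apply: (@dratio_neq2 k.+1).
  have j1 : addrel (e k.+1) (e k.+2) = 0 by apply: J; rewrite kn.
  have j2 : addrel (e k.+1) (e k) = 0 by rewrite addrelC; apply: J; rewrite k0 ltnW.
  by split; apply: addrel_roots => //; rewrite -opprB oppr_eq0.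
have d k : (2 <= k)%N -> e k.-1 - e k.+1 != 0.
  by move=> k2; rewrite -opprB oppr_eq0 dratio_neq2.
have d1 k : (0 < k)%N -> e k - e k.+1 != 0.
  by move=> k2; rewrite -opprB oppr_eq0 dratio_neq1.
have [o|o] := boolP (odd n).
  have [m en] : exists m, n = (2 * m.+2).+1 by exists (n./2 - 2)%N; lia.
  have -> : n.+1 = (2 * m.+3)%N by lia.
  have [_ hc] := V m.+2 isT ltac:(lia); have [hd _] := V m.+1 isT ltac:(lia).
  have j := J m.+2 ltac:(lia); rewrite addrelC in j.
  (* The relation is symmetric, so the four ratios may be read backwards; the conclusion then
     concerns indices 2m+6 and 2m+5. *)
  have H := @addrel_double (e m.+3) (e m.+2) (e m.+4) (e m.+1)
    (@dratio_neq0 m.+3 isT) (@dratio_neq0 m.+2 isT) (d1 m.+2 isT) (d m.+3 isT) j hc hd.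
  rewrite en dratio_double // dratio_doubleS //= addrelC -[RHS]H.
  have := (dratio_neq0 (isT : 1 < m.+3)%N, @dratio_neq1 m.+2 isT, d1 m.+2 isT, d m.+3 isT, @dratio_neq2 m.+3 isT).
  case=> -[[[h1 h2] h5] h6] h7.
  by congr addrel; field; rewrite ?al_neq0 ?h1 ?h2 ?h5 ?h6 ?h7.
have [m en] : exists m, n = (2 * m.+2)%N by exists (n./2 - 2)%N; lia.
have [_ hd] := V m.+2 isT ltac:(lia); have [hc _] := V m.+1 isT ltac:(lia).
have j := J m.+2 ltac:(lia).
have H := @addrel_double (e m.+2) (e m.+3) (e m.+1) (e m.+4)
  (@dratio_neq0 m.+2 isT) (@dratio_neq0 m.+3 isT) (@dratio_neq1 m.+2 isT)
  (@dratio_neq2 m.+2 isT) j hc hd.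
by rewrite en dratio_double // dratio_doubleS.
Qed.

Lemma dratio_prev n : (2 <= n)%N ->
  e n.-1 = (T * e n - al) / e n ^+ 2 - e n.+1.
Proof.
case: n => // -[//|n] _ /=; apply: addrel_roots; first exact: dratio_neq0.
- exact: (@dratio_neq2 n.+2).
- exact: addrel_dratio.
- by rewrite addrelC addrel_dratio.
Qed.

Lemma dratio_next n : (2 <= n)%N ->
  e n.+1 = (T * e n - al) / e n ^+ 2 - e n.-1.
Proof. by move=> n2; rewrite dratio_prev // subKr. Qed.

Lemma dratio_step n : (2 <= n)%N ->
  e n ^+ 2 * (e n.+1 - e n.-1) = 2 * e n ^+ 2 * e n.+1 - T * e n + al.
Proof.
by move=> n2; rewrite dratio_prev //; have := dratio_neq0 n2 => h; field.
Qed.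

Lemma dratio_stepS n : (2 <= n)%N ->
  e n.+1 ^+ 2 * (e n.+2 - e n) = T * e n.+1 - al - 2 * e n * e n.+1 ^+ 2.
Proof.
move=> n2; have h := @dratio_neq0 n.+1 (ltnW n2).
by rewrite (@dratio_next n.+1) 1?ltnW //=; field.
Qed.

(** * Derivatives of the ratios, for a derivation extending d/dx *)

Variables (x : K) (D : K -> K).
Hypothesis DD : forall u v, D (u + v) = D u + D v.
Hypothesis DM : forall u v, D (u * v) = D u * v + u * D v.
Hypotheses (Dal : D al = 2 * T) (DT : D T = 12 * x) (Dbe : D be = 3 * al).
Hypothesis alx : 12 * x * al = 4 * be + T ^+ 2.

Lemma der0 : D 0 = 0.
Proof. by apply: (@addrI _ (D 0)); rewrite -DD !addr0. Qed.

Lemma der1 : D 1 = 0.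
Proof.
by apply: (@addrI _ (D 1)); rewrite addr0 -{3}[1]mulr1 DM mulr1 mul1r.
Qed.

Lemma derN u : D (- u) = - D u.
Proof. by apply/eqP; rewrite -addr_eq0 -DD addNr der0. Qed.

Lemma derB u v : D (u - v) = D u - D v.
Proof. by rewrite DD derN. Qed.

Lemma derV u : D (u^-1) = - D u / u ^+ 2.
Proof.
have [->|u0] := eqVneq u 0; first by rewrite invr0 der0 oppr0 mul0r.
have : D (u * u^-1) = 0 by rewrite divff // der1.
by rewrite DM => /eqP; rewrite addrC addr_eq0 => /eqP h; apply: (mulfI u0); rewrite h; field.
Qed.

Lemma derX2 u : D (u ^+ 2) = 2 * u * D u.
Proof. by rewrite expr2 DM; ring. Qed.

Lemma der_nat n : D n%:R = 0.
Proof. by elim: n => [|n IH]; rewrite ?der0 // -addn1 natrD DD IH der1 addr0. Qed.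

(** As e_n^2 (e_(n+1) - e_(n-1)) is 4 y(Q) y([n]Q), this says that x([n]Q) has derivative n y([n]Q)
    / y(Q). For the induction, the relation between e_n and e_(n+1) is differentiated and solved for
    the derivative of e_(n+1). *)
Lemma der_dratio n : (2 <= n)%N ->
  D (e n) = 1 - n%:R * (e n ^+ 2 * (e n.+1 - e n.-1)) / al.
Proof.
elim: n => // n IH; rewrite ltnS leq_eqVlt => /orP[/eqP <-|n2].
  have h3 := G_neq0 (isT : 0 < 3)%N.
  rewrite [2.-1]/= dratio1 dratio2 !(DM, derV) Dal Dbe /dratio /= G2 G4; field.
  by rewrite ?h3 ?al_neq0.
have /(congr1 D) := addrel_dratio (ltnW n2).
move: (IH n2); rewrite dratio_stepS // dratio_step //.
(* This is the partial derivative of [addrel] in its second argument, the coefficient of the unknown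
   derivative. *)
have nz : 2 * e n ^+ 2 * e n.+1 - T * e n + al != 0.
  by rewrite -dratio_step // mulf_neq0 ?expf_neq0 ?dratio_neq0 ?dratio_neq2.
have hx : 12 * x = (4 * be + T ^+ 2) / al by rewrite -alx mulfK.
move: (addrel_dratio (ltnW n2)) nz; rewrite /addrel.
move: (e n) (e n.+1) => a b /eqP; rewrite subr_eq0 => /eqP hbe nz Da.
rewrite !(derB, DD, DM, derX2) Dal DT Dbe Da der0 hx -hbe -natr1.
move=> h; apply: (mulfI nz); apply/eqP; rewrite -subr_eq0 -h; apply/eqP.
by field.
Qed.

(* The logarithmic derivative of psi_n, where psi_n = 2 y G n for even n. *)
Definition dlog n := D (G n) / G n + (if odd n then 0 else T / al).

Lemma dlog_step n : (2 <= n)%N ->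
  dlog n.+1 + dlog n.-1 - 2 * dlog n = D (e n) / e n.
Proof.
case: n => // -[//|n] _.
have h0 := G_neq0 (ltn0Sn n); have h1 := G_neq0 (ltn0Sn n.+1); have h2 := G_neq0 (ltn0Sn n.+2).
rewrite /dlog /dratio /= !negbK !(DM, derV, derX2).
case: (odd n); rewrite /= ?derV Dal; field; by rewrite ?h0 ?h1 ?h2 ?al_neq0.
Qed.

Lemma dlog1 : dlog 1 = 0.
Proof. by rewrite /dlog /= G1 der1 mul0r addr0. Qed.

Lemma dlog2 : dlog 2 = T / al.
Proof. by rewrite /dlog /= G2 der1 mul0r add0r. Qed.

(** This is the second difference in n of [toda]: by [dlog_step], D (e n) / e n is a second
    difference of [dlog], and u -> al D u + T u is additive. It is 2y D (2y u), because T is half of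
    D al. *)
Lemma toda_step n : (2 <= n)%N ->
  al * D (D (e n) / e n) + T * (D (e n) / e n) =
    n.+1%:R ^+ 2 * e n.+1 + n.-1%:R ^+ 2 * e n.-1 - 2 * n%:R ^+ 2 * e n.
Proof.
move=> n2; have e0 := dratio_neq0 n2.
have -> : D (e n) / e n = (e n)^-1 - n%:R * (2 * e n * e n.+1 - T + al / e n) / al.
  by rewrite der_dratio // dratio_step //; field; rewrite al_neq0.
rewrite dratio_prev // -(natr1 n).
have -> : n.-1%:R = n%:R - 1 :> K by rewrite -{2}(prednK (ltnW n2)) -natr1 addrK.
move: (der_dratio n2) (@der_dratio n.+1 (ltnW n2)).
rewrite dratio_stepS // dratio_step //.
have hx : 12 * x = (4 * be + T ^+ 2) / al by rewrite -alx mulfK.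
move: (addrel_dratio (ltnW n2)) e0; rewrite /addrel.
move: (e n) (e n.+1) => a b /eqP; rewrite subr_eq0 => /eqP hbe a0 Da Db.
rewrite !(derB, DD, DM, derX2, derV, der_nat) Dal DT Da Db hx -hbe -natr1.
by field; rewrite ?a0 ?al_neq0.
Qed.

(* 2 y D (2 y dlog n) = n ^ 2 (x(Q) - x([n]Q)). *)
Lemma toda n : (0 < n)%N -> al * D (dlog n) + T * dlog n = n%:R ^+ 2 * e n.
Proof.
elim/ltn_ind: n => -[//|[|[|n]]] IH _.
- by rewrite dlog1 der0 dratio1; ring.
- rewrite dlog2 dratio2 DM derV Dal DT.
  have -> : 12 * x = (4 * be + T ^+ 2) / al by rewrite -alx mulfK.
  by field.
have := toda_step (isT : 1 < n.+2)%N; rewrite /= -dlog_step //=.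
have {IH} := (IH n.+1 (ltnW (ltnSn n.+2)) isT, IH n.+2 (ltnSn n.+2) isT).
have -> v w z : D (v + w - 2 * z) = D v + D w - 2 * D z.
  by rewrite !(der_nat, DD, derN, DM) mul0r add0r.
move: (dlog n.+1) (dlog n.+2) (dlog n.+3) => v1 v2 v3 [h1 h2] h.
have -> : al * D v3 + T * v3 =
    al * (D v3 + D v1 - 2 * D v2) + T * (v3 + v1 - 2 * v2)
    - (al * D v1 + T * v1) + 2 * (al * D v2 + T * v2) by ring.
by rewrite h h1 h2 -!natr1; ring.
Qed.

(* D (x - e n) = D x([n]Q), and 2 y D is the invariant derivation, which maps
   x([n]Q) to 2 n y([n]Q). *)
Lemma der_dratio_square n : (2 <= n)%N ->
  al * (1 - D (e n)) ^+ 2 = n%:R ^+ 2 *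
    (al - 2 * T * e n + 12 * x * e n ^+ 2 - 4 * e n ^+ 3).
Proof.
move=> n2; rewrite der_dratio // dratio_step //.
have hx : 12 * x = (4 * be + T ^+ 2) / al by rewrite -alx mulfK.
move: (addrel_dratio (ltnW n2)); rewrite /addrel.
move: (e n) (e n.+1) => a b /eqP; rewrite subr_eq0 => /eqP hbe.
by rewrite hx -hbe; field.
Qed.

End EllipticSequence.

(** * Extending a derivation to fractions *)

Section FractionDerivation.
Variables (R : idomainType) (K : fieldType) (tf : {rmorphism R -> K}).
Hypothesis tf_inj : injective tf.
Hypothesis tf_frac : forall u, exists n : R * R,
  (n.2 != 0) && (u == tf n.1 / tf n.2).
Variable d : R -> R.
Hypothesis dD : forall u v, d (u + v) = d u + d v.
Hypothesis dM : forall u v, d (u * v) = d u * v + u * d v.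

Definition fracder (u : K) : K :=
  let n := xchoose (tf_frac u) in
  tf (d n.1 * n.2 - n.1 * d n.2) / tf n.2 ^+ 2.

Let tf_neq0 a : a != 0 -> tf a != 0.
Proof. by move=> a0; rewrite -(rmorph0 tf) (inj_eq tf_inj). Qed.

(** The quotient rule does not depend on the chosen fraction: for equal fractions the
    cross-multiplied equation is differentiated inside [R]. *)
Lemma fracder_div a b : b != 0 ->
  fracder (tf a / tf b) = tf (d a * b - a * d b) / tf b ^+ 2.
Proof.
move=> b0; rewrite /fracder; have := xchooseP (tf_frac (tf a / tf b)).
set n := xchoose _ => /andP[n0 /eqP].
move: n.1 n.2 n0 => {n} c e e0.
have [B0 E0] := (tf_neq0 b0, tf_neq0 e0).
move=> h; have {h} : a * e = c * b.
  apply: tf_inj; rewrite !rmorphM /=.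
  have -> : tf a * tf e = tf a / tf b * (tf b * tf e) by field.
  by rewrite h; field.
move=> /[dup] /(congr1 d) /(congr1 tf).
rewrite !dM !rmorphD !rmorphM /= => h1 /(congr1 tf).
rewrite !rmorphM /= => h2; rewrite ?(rmorphD, rmorphN, rmorphM) /=.
have -> : tf (d a) = (tf (d c) * tf b + tf c * tf (d b) - tf a * tf (d e)) / tf e.
  by apply: (canRL (mulfK E0)); rewrite -h1 addrK.
have -> : tf a = tf c * tf b / tf e by apply: (canRL (mulfK E0)).
by field; rewrite B0 E0.
Qed.

Let split2 (P : K -> Prop) :
  (forall a b, b != 0 -> P (tf a / tf b)) -> forall u, P u.
Proof. by move=> H u; have [[a b] /= /andP[b0 /eqP ->]] := tf_frac u; apply: H. Qed.

Lemma fracderD u v : fracder (u + v) = fracder u + fracder v.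
Proof.
elim/split2: u => a b b0; elim/split2: v => c e e0.
have [B0 E0] := (tf_neq0 b0, tf_neq0 e0).
have -> : tf a / tf b + tf c / tf e = tf (a * e + c * b) / tf (b * e).
  by rewrite rmorphD !rmorphM /=; field; rewrite B0 E0.
rewrite !fracder_div ?mulf_neq0 // !dD !dM !(rmorphD, rmorphN, rmorphM) /=.
by field; rewrite B0 E0.
Qed.

Lemma fracderM u v : fracder (u * v) = fracder u * v + u * fracder v.
Proof.
elim/split2: u => a b b0; elim/split2: v => c e e0.
have [B0 E0] := (tf_neq0 b0, tf_neq0 e0).
have -> : tf a / tf b * (tf c / tf e) = tf (a * c) / tf (b * e).
  by rewrite !rmorphM /=; field; rewrite B0 E0.
rewrite !fracder_div ?mulf_neq0 // !dM !(rmorphD, rmorphN, rmorphM) /=.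
by field; rewrite B0 E0.
Qed.

Lemma fracder_tofrac a : fracder (tf a) = tf (d a).
Proof.
have d1 : d 1 = 0 by apply: (@addrI _ (d 1)); rewrite addr0 -{3}[1]mulr1 dM mulr1 mul1r.
rewrite -[tf a]divr1 -(rmorph1 tf) fracder_div ?oner_neq0 //.
by rewrite d1 mulr0 subr0 mulr1 rmorph1 expr1n divr1.
Qed.

End FractionDerivation.

Lemma tofrac_inj (R : idomainType) : injective (@FracField.tofrac R).
Proof. by move=> u v /eqP; rewrite tofrac_eq => /eqP. Qed.

Lemma tofrac_frac (R : idomainType) (u : {fraction R}) : exists n : R * R,
  (n.2 != 0) && (u == FracField.tofrac n.1 / FracField.tofrac n.2).
Proof.
elim/quotW: u => r; exists (\n_r, \d_r) => /=; rewrite denom_ratioP /=.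
have h : FracField.tofrac (\d_r) != 0 by rewrite tofrac_eq0 denom_ratioP.
apply/eqP; apply: (mulIf h); rewrite divfK //.
unlock FracField.tofrac; rewrite -[LHS]FracField.pi_mul.
apply/eqmodP; rewrite /= FracField.equivfE /FracField.mulf.
by rewrite !numden_Ratio ?mulf_neq0 ?denom_ratioP ?oner_neq0 // !mulr1 mulrC.
Qed.

(** * Coefficients at infinity *)

Section LeadingTerm.
Variable S : comNzRingType.
Implicit Types u v : {poly S}.

(** The value c may be 0, so top coefficients are computed formally, without ruling out
    cancellation, and the predicate survives reduction modulo p. *)
Definition lead_at u d c := (size u <= d.+1)%N /\ u`_d = c.

Lemma lead_atM u v m n c e :
  lead_at u m c -> lead_at v n e -> lead_at (u * v) (m + n) (c * e).
Proof.
case=> su <- [sv <-]; split.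
  by rewrite (leq_trans (size_polyMleq _ _)) //; lia.
have hm : (m < (m + n).+1)%N by lia.
rewrite coefM (bigD1 (Ordinal hm)) //= addKn big1 ?addr0 // => i.
rewrite -val_eqE /= neq_ltn => /orP[im|mi].
  by rewrite [v`_ _]nth_default ?mulr0 // (leq_trans sv) //; lia.
by rewrite nth_default ?mul0r // (leq_trans su).
Qed.

Lemma lead_atB u v m c e : lead_at u m c -> lead_at v m e -> lead_at (u - v) m (c - e).
Proof.
case=> su <- [sv <-]; split; last by rewrite coefB.
by rewrite (leq_trans (size_polyD _ _)) // size_polyN geq_max su sv.
Qed.

Lemma lead_atD u v m c e : lead_at u m c -> lead_at v m e -> lead_at (u + v) m (c + e).
Proof.
case=> su <- [sv <-]; split; last by rewrite coefD.
by rewrite (leq_trans (size_polyD _ _)) // geq_max su sv.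
Qed.

Lemma lead_at_exp u m c k : lead_at u m c -> lead_at (u ^+ k) (m * k) (c ^+ k).
Proof.
move=> h; elim: k => [|k IH]; last by rewrite mulnS !exprS; apply: lead_atM.
by rewrite muln0 !expr0; split; rewrite ?size_poly1 ?coef1.
Qed.

Lemma lead_at_nat k : lead_at (k%:R : {poly S}) 0 k%:R.
Proof. by rewrite -polyC_natr; split; rewrite ?size_polyC_leq1 ?coefC. Qed.

Lemma lead_at_cast u m n c e : lead_at u m c -> m = n -> c = e -> lead_at u n e.
Proof. by move=> h <- <-. Qed.

End LeadingTerm.

(** Unlike d/dx, this operator is diagonal on monomials, so top coefficients are compared without a
    shift in degree. *)
Definition euler (S : comNzRingType) (u : {poly S}) := 'X * u^`().

Section Euler.
Variable S : comNzRingType.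
Implicit Types u v : {poly S}.

Lemma coef_euler u i : (euler u)`_i = i%:R * u`_i.
Proof.
rewrite /euler coefXM; case: i => [|i] /=; first by rewrite mul0r.
by rewrite coef_deriv mulr_natl.
Qed.

Lemma size_euler u : (size (euler u) <= size u)%N.
Proof.
by apply/leq_sizeP => j hj; rewrite coef_euler nth_default ?mulr0.
Qed.

Lemma lead_at_euler u m c : lead_at u m c -> lead_at (euler u) m (m%:R * c).
Proof.
by case=> su <-; split; [apply: leq_trans (size_euler _) su|rewrite coef_euler].
Qed.

Lemma lead_at_size u : lead_at u (size u).-1 (lead_coef u).
Proof. by split; [exact: leqSpred | rewrite lead_coefE]. Qed.

Lemma euler2 u : euler (euler u) = euler u + 'X^2 * u^`()^`().
Proof. by rewrite /euler derivM derivX; ring. Qed.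

End Euler.

(** The quotients by c are only known to exist coefficientwise, so monomials are moved into A one at
    a time, from the top. For N = 0 this is divisibility of u by c. *)
Lemma poly_split_dvd (S : comNzRingType) (c : S) (N n : nat) (u : {poly S}) :
  (size u <= n)%N -> (forall i, (N <= i)%N -> exists v, u`_i = c * v) ->
  exists A B, [/\ u = c%:P * A + B, (size A <= n)%N & (size B <= N)%N].
Proof.
elim: n u => [|n IH] u su hu.
  exists 0, 0; rewrite !size_poly0; split=> //.
  by rewrite mulr0 addr0; apply/eqP; rewrite -size_poly_leq0.
case: (leqP N n) => [Nn|nN]; last first.
  by exists 0, u; rewrite mulr0 add0r size_poly0 (leq_trans su).
have [v hv] := hu n Nn.
have su' : (size (u - (c * v)%:P * 'X^n)%R <= n)%N.
  apply/leq_sizeP => j; rewrite leq_eqVlt => /orP[/eqP <-|nj].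
    by rewrite coefB coefCM coefXn eqxx mulr1 hv subrr.
  rewrite coefB coefCM coefXn gtn_eqF // mulr0 subr0 nth_default //.
  exact: leq_trans su nj.
have [|A [B [eu sA sB]]] := IH _ su'.
  move=> i Ni; have [w hw] := hu i Ni.
  exists (w - v * (i == n)%:R); rewrite coefB coefCM coefXn hw; ring.
exists (A + v%:P * 'X^n), B; split=> //.
  by rewrite mulrDr addrAC -eu rmorphM; ring.
rewrite (leq_trans (size_polyD _ _)) // geq_max (leq_trans sA) //=.
rewrite (leq_trans (size_polyMleq _ _)) // size_polyXn.
by have := size_polyC_leq1 v; lia.
Qed.

Section SizeBounds.
Variable S : comNzRingType.
Implicit Types u v : {poly S}.

Lemma size_mul_le u v m n N : (size u <= m)%N -> (size v <= n)%N ->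
  (m + n <= N.+1)%N -> (size (u * v)%R <= N)%N.
Proof.
move=> su sv mn; rewrite (leq_trans (size_polyMleq _ _)) //.
by rewrite -subn1 leq_subLR add1n (leq_trans (leq_add su sv)).
Qed.

Lemma size_add_le u v N : (size u <= N)%N -> (size v <= N)%N -> (size (u + v)%R <= N)%N.
Proof. by move=> su sv; rewrite (leq_trans (size_polyD _ _)) // geq_max su. Qed.

Lemma size_sub_le u v N : (size u <= N)%N -> (size v <= N)%N -> (size (u - v)%R <= N)%N.
Proof. by move=> su sv; rewrite size_add_le ?size_polyN. Qed.

Lemma size_Cmul_le c u N : (size u <= N)%N -> (size (c%:P * u)%R <= N)%N.
Proof. by move=> su; rewrite mul_polyC (leq_trans (size_scale_leq _ _)). Qed.

Lemma size_exp_le u m n : (size u <= m.+1)%N -> (size (u ^+ n)%R <= (m * n).+1)%N.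
Proof.
move=> su; elim: n => [|n IH]; first by rewrite expr0 size_poly1 muln0.
by rewrite exprS mulnS; apply: size_mul_le su IH _; lia.
Qed.

Lemma size_euler_le u N : (size u <= N)%N -> (size (euler u) <= N)%N.
Proof. exact: leq_trans (size_euler u). Qed.

Lemma lead_at_sizeE u n c : lead_at u n c -> c != 0 -> size u = n.+1.
Proof.
case=> su <- c0; apply/eqP; rewrite eqn_leq su ltnNge.
by apply: contraNN c0 => h; rewrite nth_default.
Qed.

End SizeBounds.

(** * Differential equations for the division polynomials *)

Section DivisionPolynomial.
Variables (S : comNzRingType) (a b : S).

Definition curve_cubic : {poly S} := 'X^3 + a *: 'X + b%:P.
Local Notation f := curve_cubic.
Definition divpoly := reduced_dpoly a%:P b%:P 'X f.
Local Notation g := divpoly.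

Lemma lead_cubic : lead_at f 3 1.
Proof.
split; last by rewrite !coefE /= mulr0 !addr0.
rewrite /f -addrA (leq_trans (size_polyD _ _)) // size_polyXn geq_max leqnn /=.
rewrite (leq_trans (size_polyD _ _)) // geq_max (leq_trans (size_polyC_leq1 _)) //.
by rewrite andbT (leq_trans (size_scale_leq _ _)) // size_polyX.
Qed.

Lemma divpoly_odd m : (2 <= m)%N -> g (2 * m + 1) =
  if odd m then g (m + 2)%N * g m ^+ 3 - 16 * f ^+ 2 * g (m - 1)%N * g (m + 1)%N ^+ 3
  else 16 * f ^+ 2 * g (m + 2)%N * g m ^+ 3 - g (m - 1)%N * g (m + 1)%N ^+ 3.
Proof. exact: reduced_dpoly_odd. Qed.

Lemma divpoly_even m : (3 <= m)%N -> g (2 * m) =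
  g m * (g (m + 2)%N * g (m - 1)%N ^+ 2 - g (m - 2)%N * g (m + 1)%N ^+ 2).
Proof. exact: reduced_dpoly_even. Qed.

Lemma divpoly3 : g 3 = 3 * 'X^4 + 6 * a%:P * 'X^2 + 12 * b%:P * 'X - a%:P ^+ 2.
Proof. by []. Qed.

Lemma divpoly4 : g 4 = 2 * 'X^6 + 10 * a%:P * 'X^4 + 40 * b%:P * 'X^3
  - 10 * a%:P ^+ 2 * 'X^2 - 8 * a%:P * b%:P * 'X - 2 * (a%:P ^+ 3 + 8 * b%:P ^+ 2).
Proof. by []. Qed.

(** These are (n^2 - 1)/2 and (n^2 - 4)/2: psi_n^2 has leading term n^2 x^(n^2-1), and for even n
    the factor 4y^2 is removed from it. *)
Definition divpoly_deg n := if odd n then (2 * n./2 * n./2.+1)%N else (2 * n./2.-1 * n./2.+1)%N.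

Lemma divpoly_deg_odd k : divpoly_deg (2 * k + 1) = (2 * k * k.+1)%N.
Proof. by rewrite /divpoly_deg; have [-> ->] : odd (2 * k + 1) /\ (2 * k + 1)./2 = k by lia. Qed.

Lemma divpoly_deg_even k : divpoly_deg (2 * k) = (2 * k.-1 * k.+1)%N.
Proof. by rewrite /divpoly_deg; have [-> ->] : odd (2 * k) = false /\ (2 * k)./2 = k by lia. Qed.

Definition divpoly_lead n := if odd n then n else n./2.

Lemma divpoly_lead_odd k : divpoly_lead (2 * k + 1) = (2 * k + 1)%N.
Proof. by rewrite /divpoly_lead; have -> : odd (2 * k + 1) by lia. Qed.

Lemma divpoly_lead_even k : divpoly_lead (2 * k) = k.
Proof. by rewrite /divpoly_lead; have [-> ->] : odd (2 * k) = false /\ (2 * k)./2 = k by lia. Qed.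

(** Both terms of each recursion have the same formal degree. Splitting n modulo 4 fixes the parity
    of every index that occurs. *)
Lemma lead_divpoly n : (0 < n)%N -> lead_at (g n) (divpoly_deg n) (divpoly_lead n)%:R.
Proof.
elim/ltn_ind: n => n IH n0.
case: (ltnP n 5) => [n5|n5].
  case: n {IH} n0 n5 => [//|[|[|[|[|//]]]]] _ _.
  - by split; rewrite ?size_poly1 ?coef1.
  - by split; rewrite ?size_poly1 ?coef1.
  - have -> : g 3 = \poly_(i < 5) [:: - a ^+ 2; 12 * b; 6 * a; 0; 3]`_i.
      rewrite poly_def !big_ord_recl big_ord0 divpoly3 /=; rewrite -!mul_polyC.
      by rewrite ?(rmorphM, rmorphN, rmorphXn, rmorph0, rmorph_nat) /=; ring.
    by split; [apply: size_poly | rewrite coef_poly].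
  - have -> : g 4 = \poly_(i < 7) [:: - 2 * (a ^+ 3 + 8 * b ^+ 2); - 8 * a * b;
        - 10 * a ^+ 2; 40 * b; 10 * a; 0; 2]`_i.
      rewrite poly_def !big_ord_recl big_ord0 divpoly4 /=; rewrite -!mul_polyC.
      rewrite ?(rmorphD, rmorphM, rmorphN, rmorphXn, rmorph0, rmorph_nat) /=; ring.
    by split; [apply: size_poly | rewrite coef_poly].
have lf : lead_at (16 * f ^+ 2) 6 16.
  by have := lead_atM (lead_at_nat S 16) (lead_at_exp 2 lead_cubic); rewrite expr1n mulr1.
have IHo k : (2 * k + 1 < n)%N -> lead_at (g (2 * k + 1)) (2 * k * k.+1) (2 * k%:R + 1).
  move=> kn; apply: lead_at_cast (IH _ kn _) _ _; rewrite ?divpoly_deg_odd ?divpoly_lead_odd ?addn1 //.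
  by rewrite -natr1 natrM.
have IHe k : (0 < k)%N -> (2 * k < n)%N -> lead_at (g (2 * k)) (2 * k.-1 * k.+1) k%:R.
  by move=> k0 kn; apply: lead_at_cast (IH _ kn _) _ _;
     rewrite ?muln_gt0 ?divpoly_deg_even ?divpoly_lead_even.
have [o|o] := boolP (odd n); last first.
  have [m en] : exists m, n = (2 * m)%N by exists n./2; lia.
  have m3 : (3 <= m)%N by lia.
  rewrite en divpoly_deg_even divpoly_lead_even divpoly_even //.
  have [om|om] := boolP (odd m).
    have [k em] : exists k, m = (2 * k.+1 + 1)%N by exists (m./2.-1); lia.
    have -> : (m + 2 = 2 * k.+2 + 1)%N by lia.
    have -> : (m - 1 = 2 * k.+1)%N by lia.
    have -> : (m - 2 = 2 * k + 1)%N by lia.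
    have -> : (m + 1 = 2 * k.+2)%N by lia.
    rewrite em; apply: lead_at_cast.
    - apply: lead_atM; [by apply: IHo; lia|apply: lead_atB; last first].
        by apply: lead_atM; [apply: IHo|apply: lead_at_exp; apply: IHe]; lia.
      apply: lead_at_cast; first by
        apply: lead_atM; [apply: IHo|apply: lead_at_exp; apply: IHe]; lia.
      + by nia.
      + by [].
    - by nia.
    - by rewrite !(natrD, natrM) -!natr1; ring.
  have [k em] : exists k, m = (2 * k.+2)%N by exists (m./2.-2); lia.
  have -> : (m + 2 = 2 * k.+3)%N by lia.
  have -> : (m - 1 = 2 * k.+1 + 1)%N by lia.
  have -> : (m - 2 = 2 * k.+1)%N by lia.
  have -> : (m + 1 = 2 * k.+2 + 1)%N by lia.
  rewrite em; apply: lead_at_cast.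
  - apply: lead_atM; [by apply: IHe; lia|apply: lead_atB; last first].
      by apply: lead_atM; [apply: IHe|apply: lead_at_exp; apply: IHo]; lia.
    apply: lead_at_cast; first by
      apply: lead_atM; [apply: IHe|apply: lead_at_exp; apply: IHo]; lia.
    + by nia.
    + by [].
  - by nia.
  - by rewrite natrM -!natr1; ring.
have [m en] : exists m, n = (2 * m + 1)%N by exists n./2; lia.
have m2 : (2 <= m)%N by lia.
rewrite en divpoly_deg_odd divpoly_lead_odd divpoly_odd //.
have [om|om] := boolP (odd m).
  have [k em] : exists k, m = (2 * k.+1 + 1)%N by exists (m./2.-1); lia.
  have -> : (m + 2 = 2 * k.+2 + 1)%N by lia.
  have -> : (m - 1 = 2 * k.+1)%N by lia.
  have -> : (m + 1 = 2 * k.+2)%N by lia.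
  rewrite em; apply: lead_at_cast.
  - apply: lead_atB; last first.
      by apply: lead_atM; [apply: lead_atM; [exact: lf|apply: IHe]|apply: lead_at_exp; apply: IHe]; lia.
    apply: lead_at_cast; first by
      apply: lead_atM; [apply: IHo|apply: lead_at_exp; apply: IHo]; lia.
    + by nia.
    + by [].
  - by nia.
  - by rewrite !(natrD, natrM) -!natr1; ring.
have [k em] : exists k, m = (2 * k.+1)%N by exists (m./2.-1); lia.
have -> : (m + 2 = 2 * k.+2)%N by lia.
have -> : (m - 1 = 2 * k + 1)%N by lia.
have -> : (m + 1 = 2 * k.+1 + 1)%N by lia.
rewrite em; apply: lead_at_cast.
- apply: lead_atB.
    by apply: lead_atM; [apply: lead_atM; [exact: lf|apply: IHe]|apply: lead_at_exp; apply: IHe]; lia.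
  apply: lead_at_cast; first by
    apply: lead_atM; [apply: IHo|apply: lead_at_exp; apply: IHo]; lia.
  + by nia.
  + by [].
- by nia.
- by rewrite !(natrD, natrM) -!natr1; ring.
Qed.

End DivisionPolynomial.

(** * Value of the odd division polynomials at a 2-torsion point *)

Section SpecialValue.
Variables (S k : comNzRingType) (h : {rmorphism S -> k}) (a b : S).
Hypotheses (ha : h a = 1) (hb : h b = 0).
Local Notation ev := (fun u : {poly S} => h u.[0]).

(* The specialization A = 1, B = 0, x = 0 is the 2-torsion point (0, 0). *)
Lemma divpoly_special n : odd n -> h (divpoly a b n).[0] ^+ 2 = 1.
Proof.
elim/ltn_ind: n => n IH o.
case: (ltnP n 5) => [n5|n5].
  case: n {IH} o n5 => [|[|[|[|[|]]]]] // _ _; first by rewrite hornerC rmorph1 expr1n.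
  rewrite divpoly3 !hornerE /= !(rmorphB, rmorphD, rmorphM, rmorphXn) /= ?ha ?hb.
  by rewrite ?(rmorph0, expr0n, mulr0, addr0, sub0r) /=; ring.
(* Since f vanishes at the special point, the term with f^2 drops out of the recursion; the
   surviving one has only odd indices. *)
have hf : (curve_cubic a b).[0] = b by rewrite !hornerE expr0n /=; ring.
have [m en] : exists m, n = (2 * m + 1)%N by exists n./2; lia.
have m2 : (2 <= m)%N by lia.
rewrite en divpoly_odd //; case: ifP => om.
  rewrite !(hf, hornerE) !(rmorphB, rmorphM) /= hb.
  transitivity ((h (divpoly a b (m + 2)).[0] ^+ 2) * (h (divpoly a b m).[0] ^+ 2) ^+ 3).
    by ring.
  by rewrite !IH ?mul1r ?expr1n //; lia.
rewrite !(hf, hornerE) !(rmorphB, rmorphM) /= hb.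
transitivity ((h (divpoly a b (m - 1)).[0] ^+ 2) * (h (divpoly a b (m + 1)).[0] ^+ 2) ^+ 3).
  by ring.
by rewrite !IH ?mul1r ?expr1n //; lia.
Qed.
End SpecialValue.

Section DifferentialEquations.
Variables (S : idomainType) (a b : S).
Hypothesis char0 : [pchar S] =i pred0.
Local Notation f := (curve_cubic a b).
Local Notation g := (divpoly a b).
Local Notation K := {fraction {poly S}}.

Lemma natS_neq0 n : (0 < n)%N -> n%:R != 0 :> S.
Proof. by move=> n0; move/pcharf0P: char0 => ->; rewrite -lt0n. Qed.

Lemma divpoly_neq0 n : (0 < n)%N -> g n != 0.
Proof.
move=> n0; have [_ h] := lead_divpoly a b n0; apply: contra_eqN h => /eqP ->.
rewrite coef0 eq_sym natS_neq0 // /divpoly_lead; case: ifP => // o; lia.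
Qed.

Lemma curve_cubic_neq0 : f != 0.
Proof.
have [_ h] := lead_cubic a b; apply: contra_eqN h => /eqP ->.
by rewrite coef0 eq_sym oner_neq0.
Qed.

Lemma deriv_cubic : f^`() = 3 * 'X^2 + a%:P.
Proof.
rewrite /curve_cubic -mul_polyC !derivE /= addr0 mulr1.
by rewrite -mulr_natl.
Qed.

(* For odd n, x([n]Q) = x - divpoly_tail n / psi_n ^ 2. *)
Definition divpoly_tail n := 4 * f * g n.-1 * g n.+1.
Local Notation kappa := divpoly_tail.

(** * Both differential equations, in an abstract differential field containing S[x] *)

Section Generic.
Variables (F : fieldType) (tf : {rmorphism {poly S} -> F}) (D : F -> F).
Hypothesis tf_inj : injective tf.
Hypothesis DD : forall u v, D (u + v) = D u + D v.
Hypothesis DM : forall u v, D (u * v) = D u * v + u * D v.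
Hypothesis Dtf : forall u, D (tf u) = tf u^`().

Let al := tf (4 * f).
Let T := tf (2 * (3 * 'X^2 + a%:P)).
Let G n := tf (g n).

Let tf_neq0 u : u != 0 -> tf u != 0.
Proof. by move=> u0; rewrite -(rmorph0 tf) (inj_eq tf_inj). Qed.

Let al_neq0 : al != 0.
Proof.
apply: tf_neq0; rewrite mulf_neq0 ?curve_cubic_neq0 //.
by rewrite -polyC_natr polyC_eq0 natS_neq0.
Qed.

Let G_neq0 n : (0 < n)%N -> G n != 0.
Proof. by move=> n0; apply/tf_neq0/divpoly_neq0. Qed.

Let G0 : G 0 = 0. Proof. exact: rmorph0. Qed.
Let G1 : G 1 = 1. Proof. exact: rmorph1. Qed.
Let G2 : G 2 = 1. Proof. exact: rmorph1. Qed.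

Let G4 : G 4 = T * G 3 - al ^+ 2.
Proof.
rewrite /G /T /al.
have -> : g 4 = 2 * (3 * 'X^2 + a%:P) * g 3 - (4 * f) ^+ 2.
  by rewrite divpoly3 divpoly4 /curve_cubic -mul_polyC; ring.
by rewrite rmorphB rmorphM rmorphXn.
Qed.

Let G_odd m : (2 <= m)%N -> G (2 * m + 1)%N =
  if odd m then G (m + 2)%N * G m ^+ 3 - al ^+ 2 * G (m - 1)%N * G (m + 1)%N ^+ 3
  else al ^+ 2 * G (m + 2)%N * G m ^+ 3 - G (m - 1)%N * G (m + 1)%N ^+ 3.
Proof.
move=> m2; rewrite /G divpoly_odd //.
have -> : 16 * f ^+ 2 = (4 * f) ^+ 2 by ring.
rewrite /al; move: (4 * f) => q.
by case: (odd m); rewrite !(rmorphB, rmorphXn, rmorphM).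
Qed.

Let G_even m : (3 <= m)%N -> G (2 * m)%N =
  G m * (G (m + 2)%N * G (m - 1)%N ^+ 2 - G (m - 2)%N * G (m + 1)%N ^+ 2).
Proof. by move=> m3; rewrite /G divpoly_even // !(rmorphB, rmorphXn, rmorphM). Qed.

Let Dal : D al = 2 * T.
Proof.
rewrite /al Dtf /T; have -> : 4 * f = 4%:R%:P * f by rewrite polyC_natr.
by rewrite deriv_mulC deriv_cubic polyC_natr !rmorphM !rmorph_nat; ring.
Qed.

Let DT : D T = 12 * tf 'X.
Proof.
rewrite /T Dtf; have -> : 2 * (3 * 'X^2 + a%:P) = 6%:R%:P * 'X^2 + 2%:R%:P * a%:P.
  by rewrite !polyC_natr; ring.
rewrite !derivE /= polyC_natr mulr0 addr0 -['X *+ 2]mulr_natl mulrA -natrM.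
by rewrite rmorphM rmorph_nat.
Qed.

Let Dbe : D (G 3) = 3 * al.
Proof.
rewrite /G Dtf /al -(rmorph_nat tf 3) -rmorphM divpoly3 /curve_cubic -mul_polyC.
have -> : 3 * 'X^4 + 6 * a%:P * 'X^2 + 12 * b%:P * 'X - a%:P ^+ 2 =
  3%:R%:P * 'X^4 + (6 * a)%:P * 'X^2 + (12 * b)%:P * 'X - (a ^+ 2)%:P.
  by rewrite !(rmorphM, rmorphXn, rmorph_nat).
by congr (tf _); rewrite !derivE /= !(rmorphM, rmorph_nat); ring.
Qed.

Let alx : 12 * tf 'X * al = 4 * G 3 + T ^+ 2.
Proof.
rewrite /al /G /T.
transitivity (tf (12 * 'X * (4 * f))); first by rewrite !rmorphM !rmorph_nat.
have -> : 12 * 'X * (4 * f) = 4 * g 3 + (2 * (3 * 'X^2 + a%:P)) ^+ 2.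
  by rewrite divpoly3 /curve_cubic -mul_polyC; ring.
by rewrite rmorphD rmorphXn rmorphM rmorph_nat.
Qed.

Let ratio_odd n : odd n -> dratio al G n = tf (kappa n) / G n ^+ 2.
Proof. by move=> o; rewrite /dratio o /divpoly_tail /al; move: (4 * f) => q; rewrite !rmorphM. Qed.

Lemma toda_tf n : odd n ->
  4 * f * (g n * (g n)^`()^`() - (g n)^`() ^+ 2)
  + 2 * (3 * 'X^2 + a%:P) * g n * (g n)^`() = n%:R ^+ 2 * kappa n.
Proof.
move=> o; have n0 : (0 < n)%N by case: n o.
have := toda al_neq0 G_neq0 G0 G1 G2 G4 G_odd G_even DD DM Dal DT Dbe alx n0.
rewrite ratio_odd // /dlog o addr0 !DM (derV DD DM) /G !Dtf /al /T => h.
have u0 := G_neq0 n0; rewrite /G in u0.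
apply: tf_inj; move: u0 h; move: (g n) (kappa n) (4 * f) (2 * _) => u k A B u0.
rewrite !(rmorphB, rmorphD, rmorphXn, rmorphM, rmorph_nat) /= => h.
have -> : n%:R ^+ 2 * tf k = n%:R ^+ 2 * (tf k / tf u ^+ 2) * tf u ^+ 2 by field.
by rewrite -h; field.
Qed.

(** This is [der_dratio_square] with denominators cleared by psi^6. Its right-hand bracket is 4
    times the cubic evaluated at x - e_n = phi / psi^2. *)
Lemma der_square_tf n : odd n -> (3 <= n)%N ->
  let phi := 'X * g n ^+ 2 - kappa n in
  f * (phi^`() * g n - 2 * phi * (g n)^`()) ^+ 2 =
    n%:R ^+ 2 * (phi ^+ 3 + a%:P * phi * g n ^+ 4 + b%:P * g n ^+ 6).
Proof.
move=> o n3 phi.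
have := der_dratio_square al_neq0 G_neq0 G0 G1 G2 G4 G_odd G_even DD DM Dal DT Dbe alx (ltnW n3).
have n0 : (0 < n)%N by lia.
have u0 := G_neq0 n0; rewrite /G in u0.
have tf4 : tf 4 != 0.
  by apply: tf_neq0; rewrite -polyC_natr polyC_eq0 natS_neq0.
rewrite ratio_odd // !DM (derV DD DM) (derX2 DM) /G !Dtf => h.
apply: tf_inj; apply: (mulfI tf4).
have [k ek] : exists k, kappa n = k by exists (kappa n).
have hf : tf f = tf 'X ^+ 3 + tf a%:P * tf 'X + tf b%:P.
  by rewrite /curve_cubic -mul_polyC !rmorphD rmorphXn rmorphM.
move: u0 h hf; rewrite /al /T {}/phi {}ek; move: (g n) f => u c u0.
have -> : ('X * u ^+ 2 - k)^`() = u ^+ 2 + 2 * 'X * (u * u^`()) - k^`().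
  by rewrite derivB derivM derivX expr2 derivM; ring.
rewrite !(rmorph_nat, rmorphB, rmorphD, rmorphXn, rmorphM) /= => h hc.
transitivity (4 * tf c * (1 - (tf k^`() / tf u ^+ 2 +
    tf k * (- (2 * tf u * tf u^`()) / (tf u ^+ 2) ^+ 2))) ^+ 2 * tf u ^+ 6).
  by field.
by rewrite h hc; field.
Qed.
End Generic.

Let deriv_add (u v : {poly S}) : (u + v)^`() = u^`() + v^`(). Proof. exact: derivD. Qed.
Let deriv_mul (u v : {poly S}) : (u * v)^`() = u^`() * v + u * v^`(). Proof. exact: derivM. Qed.

Let tf := @FracField.tofrac {poly S}.
Let D := fracder (@tofrac_frac {poly S}) (@deriv S).
Let DD := fracderD (@tofrac_inj _) (@tofrac_frac {poly S}) deriv_add deriv_mul.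
Let DM := fracderM (@tofrac_inj _) (@tofrac_frac {poly S}) deriv_mul.
Let Dtf := fracder_tofrac (@tofrac_inj _) (@tofrac_frac {poly S}) deriv_mul.

Lemma divpoly_toda n : odd n ->
  4 * f * (g n * (g n)^`()^`() - (g n)^`() ^+ 2)
  + 2 * (3 * 'X^2 + a%:P) * g n * (g n)^`() = n%:R ^+ 2 * kappa n.
Proof. exact: (toda_tf (@tofrac_inj _) DD DM Dtf). Qed.

Lemma divpoly_der_square n : odd n -> (3 <= n)%N ->
  let phi := 'X * g n ^+ 2 - kappa n in
  f * (phi^`() * g n - 2 * phi * (g n)^`()) ^+ 2 =
    n%:R ^+ 2 * (phi ^+ 3 + a%:P * phi * g n ^+ 4 + b%:P * g n ^+ 6).
Proof. exact: (der_square_tf (@tofrac_inj _) DD DM Dtf). Qed.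

End DifferentialEquations.

(** * Characteristic p *)

Section CharP.
Variables (S : idomainType) (k : nat).
Local Notation p := (2 * k + 1)%N.
Hypothesis charS : p \in [pchar S].
Variables (a b : S).
Local Notation f := (curve_cubic a b).

Let two_neq0 : 2 != 0 :> S.
Proof.
rewrite -(dvdn_pcharf charS); have := prime_gt1 (pcharf_prime charS).
by case: k => // j _; apply/negP => /dvdn_leq; lia.
Qed.

Section Toda.
Variable q : {poly S}.
Hypothesis toda_q :
  4 * f * (q * q^`()^`() - q^`() ^+ 2) + 2 * (3 * 'X^2 + a%:P) * q * q^`() = 0.
Hypothesis q0 : q != 0.
Local Notation m := (size q).-1.

Let theta : q * (4 * f * (euler (euler q) - euler q)
  + 2 * ('X * (3 * 'X^2 + a%:P)) * euler q) = 4 * f * euler q ^+ 2.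
Proof.
rewrite euler2 /euler; apply/eqP; rewrite -subr_eq0; apply/eqP.
by rewrite -[RHS](mulr0 'X^2) -toda_q; ring.
Qed.

Let lead4f : lead_at (4 * f) 3 4.
Proof. by have := lead_atM (lead_at_nat S 4) (lead_cubic a b); rewrite mulr1. Qed.

Let lead_df : lead_at (2 * ('X * (3 * 'X^2 + a%:P))) 3 6.
Proof.
have -> : 2 * ('X * (3 * 'X^2 + a%:P)) = 6%:R%:P * 'X^3 + (2 * a)%:P * 'X.
  by rewrite rmorphM !polyC_natr; ring.
split; last by rewrite !coefE /= mulr0 addr0 mulr1.
rewrite (leq_trans (size_polyD _ _)) // geq_max.
by rewrite !(leq_trans (size_polyMleq _ _)) // ?size_polyXn ?size_polyX ?addn4 ?addn2 /= ?ltnS ?size_polyC_leq1 // (leq_trans (size_polyC_leq1 _)).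
Qed.

(** The coefficients of x^(2m+3) in [theta] differ by 2 m c^2, where c is the leading coefficient of
    q. *)
Lemma dvdn_toda_size : (p %| m)%N.
Proof.
have hq := lead_at_size q.
have h1 := lead_at_euler hq; have h2 := lead_at_euler h1.
have [_ hl] := lead_atM hq (lead_atD (lead_atM lead4f (lead_atB h2 h1)) (lead_atM lead_df h1)).
have [_ hr] := lead_atM lead4f (lead_at_exp 2 h1).
have e : (m + (3 + m) = 3 + m * 2)%N by lia.
move: hl; rewrite theta e hr => /eqP; rewrite -subr_eq0.
set c := lead_coef q; set n := m%:R.
have -> : 4 * (n * c) ^+ 2 - c * (4 * (n * (n * c) - n * c) + 6 * (n * c)) =
  - (2 * n * c ^+ 2) by ring.
rewrite oppr_eq0 !mulf_eq0 (negPf two_neq0) /= orbb /c lead_coef_eq0 (negPf q0) orbF.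
by rewrite /n -(dvdn_pcharf charS).
Qed.

(** Let r be the degree of [euler q]. Then r < m because p divides m, so the right side of [theta]
    has degree below m + r + 3, and the coefficient there forces p to divide 2r + 1. *)
Lemma toda_euler_size : euler q != 0 -> (size (euler q) + k <= m)%N.
Proof.
move=> w0; have [r er] : exists r, size (euler q) = r.+1.
  by exists (size (euler q)).-1; rewrite prednK // size_poly_gt0.
have hq := lead_at_size q; have hw := lead_at_size (euler q); rewrite er /= in hw.
have h1 := lead_at_euler hw.
have e0 : lead_coef (euler q) != 0 by rewrite lead_coef_eq0.
have p0 : (0 < p)%N by rewrite addn1.
have rm : (r < m)%N.
  have rq : (r <= m)%N by rewrite -ltnS -er (leq_trans (size_euler _)) // leqSpred.
  rewrite ltn_neqAle rq andbT; apply: contraNneq e0 => rm.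
  rewrite lead_coefE er /= coef_euler rm; have := dvdn_toda_size.
  by rewrite (dvdn_pcharf charS) => /eqP ->; rewrite mul0r.
have [_ hl] := lead_atM hq (lead_atD (lead_atM lead4f (lead_atB h1 hw)) (lead_atM lead_df hw)).
have [hs _] := lead_atM lead4f (lead_at_exp 2 hw).
move: hl; rewrite theta nth_default; last first.
  by apply: leq_trans hs _; rewrite muln2 -addnn [(_.-1 + _)%N]addnCA ltn_add2l ltn_add2r.
set c := lead_coef q; set e := lead_coef (euler q).
have -> : c * (4 * (r%:R * e - e) + 6 * e) = 2 * c * e * (2 * r + 1)%:R.
  by rewrite natrD natrM; ring.
move/esym/eqP; rewrite !mulf_eq0 (negPf two_neq0) /c lead_coef_eq0 (negPf q0) (negPf e0) /=.
rewrite -(dvdn_pcharf charS) => /dvdnP[i ei]; have /dvdnP[j ej] := dvdn_toda_size.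
(* Both 2r + 1 and 2m are multiples of p, so they differ by at least p = 2k + 1. *)
have ij : (i < 2 * j)%N by rewrite -(ltn_pmul2r p0) -ei -mulnA -ej; lia.
have : (i.+1 * p <= 2 * j * p)%N by rewrite leq_mul2r ij orbT.
rewrite er mulSn -ei -mulnA -ej => h.
by rewrite -(leq_pmul2l (isT : 0 < 2)%N); apply: leq_trans h; lia.
Qed.

(* The derivative of phi / q ^+ 2 vanishes, so the logarithmic derivative of phi
   is as small at infinity as that of q. *)
Lemma der_quotient_coef phi j : lead_at phi (p ^ 2) 1 ->
  phi^`() * q = 2 * phi * q^`() -> (p ^ 2 - k <= j < p ^ 2)%N -> phi`_j = 0.
Proof.
move=> hphi der /andP[j1 j2].
have [sphi _] := hphi.
have hk : (0 < k)%N by have := prime_gt1 (pcharf_prime charS); lia.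
have eq : euler phi * q = 2 * phi * euler q.
  by rewrite /euler -mulrA der; ring.
(* The range of j lies strictly between p (p - 1) and p^2, hence contains no multiple of p. *)
have jp : j%:R != 0 :> S.
  rewrite -(dvdn_pcharf charS); apply/negP => /dvdnP[i ei].
  move: j1 j2; rewrite ei expnS expn1 => j1; rewrite ltn_mul2r => /andP[_ ip].
  have : (i.+1 * p <= p * p)%N by rewrite leq_mul2r ip orbT.
  by rewrite mulSn; lia.
apply: (mulfI jp); rewrite mulr0 -coef_euler nth_default //.
have [z0|z0] := eqVneq (euler phi) 0; first by rewrite z0 size_poly0.
have w0 : euler q != 0.
  apply: contraNneq z0 => w0; move/eqP: eq.
  by rewrite w0 mulr0 mulf_eq0 (negPf q0) orbF.
suff hs : (size (euler phi) <= p ^ 2 - k)%N by apply: leq_trans j1.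
have hz : (size (euler phi * q)%R <= p ^ 2 + size (euler q))%N.
  have h2 : lead_at (2 * phi) (p ^ 2) 2.
    by have := lead_atM (lead_at_nat S 2) hphi; rewrite mulr1.
  rewrite eq (leq_trans (size_polyMleq _ _)) // -ltnS prednK.
    by rewrite -addSn leq_add2r; case: h2.
  by rewrite addn_gt0 !size_poly_gt0 w0 orbT.
have hw := toda_euler_size w0.
have hq : (0 < size q)%N by rewrite size_poly_gt0.
have he : (0 < size (euler phi))%N by rewrite size_poly_gt0.
move: hz; rewrite size_mul //; move: hw hq he; move: (size (euler phi)) (size (euler q)) (size q) (p ^ 2)%N => x y z P. lia.
Qed.

End Toda.
End CharP.

(** * Passage from characteristic zero to characteristic p *)

Section Reduction.
Variables (S S' : idomainType) (pi : {rmorphism S -> S'}) (k : nat).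
Local Notation p := (2 * k + 1)%N.
Hypothesis charS : [pchar S] =i pred0.
Hypothesis charS' : p \in [pchar S'].
Hypothesis ker_pi : forall u, pi u = 0 -> exists v, u = p%:R * v.
Variables (a b : S) (h : {rmorphism S -> int}).
Hypotheses (ha : h a = 1) (hb : h b = 0).

Local Notation f := (curve_cubic a b).
Local Notation psi := (divpoly a b p).
Local Notation kappa := (divpoly_tail a b p).
Local Notation f' := (curve_cubic (pi a) (pi b)).
Local Notation phi := ('X * psi ^+ 2 - kappa).
Local Notation mp := (map_poly pi).
(** [P], [d] and [M] are p^2, (p^2 - 1)/2 and p (p - 1)/2, expanded so that linear arithmetic can
    treat k * k as an atom. Note d = M + k. *)
Local Notation P := (4 * (k * k) + 4 * k + 1)%N.
Local Notation d := (2 * (k * k) + 2 * k)%N.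
Local Notation M := (2 * (k * k) + k)%N.

Let oddp : odd p. Proof. lia. Qed.
Let k0 : (0 < k)%N.
Proof. by have := prime_gt1 (pcharf_prime charS'); lia. Qed.
Let PE : (p ^ 2 = P)%N. Proof. nia. Qed.
Let pi_p : pi p%:R = 0. Proof. by rewrite rmorph_nat pcharf0. Qed.
Let p_neq0 : p%:R != 0 :> S. Proof. by apply: natS_neq0 => //; lia. Qed.

Let lead_psi : lead_at psi d p%:R.
Proof.
have := lead_divpoly a b (isT : 0 < (2 * k).+1)%N; rewrite -addn1 divpoly_deg_odd divpoly_lead_odd.
by move=> H; apply: lead_at_cast H _ _ => //; nia.
Qed.

Let lead_kappa : lead_at kappa P (p%:R ^+ 2 - 1).
Proof.
rewrite /divpoly_tail addn1 /=.
have e : ((2 * k).+2 = 2 * k.+1)%N by lia.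
have k2 : (0 < 2 * k)%N by lia.
have k3 : (0 < 2 * k.+1)%N by lia.
have H := lead_atM (lead_atM (lead_atM (lead_at_nat S 4) (lead_cubic a b))
  (lead_divpoly a b k2)) (lead_divpoly a b k3).
rewrite e; apply: lead_at_cast H _ _; rewrite ?divpoly_deg_even ?divpoly_lead_even.
  by have [j ->] : exists j, k = j.+1; [exists k.-1; lia|rewrite /=; nia].
  by rewrite -!natr1 natrM; ring.
Qed.

Let lead_phi : lead_at phi P 1.
Proof.
have hX : lead_at ('X : {poly S}) 1 1 by split; rewrite ?size_polyX ?coefX.
have H := lead_atM hX (lead_at_exp 2 lead_psi).
have e : (1 + d * 2 = P)%N by lia.
rewrite e in H; apply: lead_at_cast (lead_atB H lead_kappa) _ _ => //; ring.
Qed.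

Local Notation q := (mp psi).

(** The leading coefficient p vanishes modulo p, so the special value is used: if p divided psi,
    then p^2 would divide 1. *)
Let q_neq0 : q != 0.
Proof.
apply/eqP => q0.
have [|A [B [eq sA sB]]] := @poly_split_dvd S p%:R 0 _ psi (leqnn _).
  by move=> i _; apply: ker_pi; rewrite -coef_map q0 coef0.
have /eqP := divpoly_special ha hb oddp.
rewrite eq; have -> : B = 0 by apply/eqP; rewrite -size_poly_leq0.
rewrite addr0 hornerM hornerC rmorphM rmorph_nat.
have : (2 < p)%N by lia.
move: (2 * k + 1)%N => n n3; move: (h _) => z /eqP.
rewrite exprMn -natrX => H.
have : (n ^ 2 %| 1)%N by rewrite -(dvdzE (n ^ 2)%:Z 1) -H natz dvdz_mulr.
by rewrite dvdn1; nia.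
Qed.

Let map_f : mp f = f'.
Proof. by rewrite /curve_cubic !rmorphD /= map_polyZ map_polyXn map_polyX map_polyC. Qed.

Let map_p2 u : mp (p%:R ^+ 2 * u) = 0.
Proof.
rewrite rmorphM rmorphXn rmorph_nat /=.
have -> : p%:R = 0 :> {poly S'} by rewrite -polyC_natr pcharf0.
by rewrite expr0n mul0r.
Qed.

Let toda_q : 4 * f' * (q * q^`()^`() - q^`() ^+ 2)
  + 2 * (3 * 'X^2 + (pi a)%:P) * q * q^`() = 0.
Proof.
have /(congr1 mp) := divpoly_toda a b charS oddp.
rewrite map_p2; move: map_f; move: psi kappa f => u t F mF.
rewrite !(rmorph_nat, rmorphB, rmorphD, rmorphXn, rmorphM) /= !deriv_map mF.
by rewrite map_polyX map_polyC /= => ->.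
Qed.

Let rho := phi^`() * psi - 2 * phi * psi^`().

Let rho_square : f * rho ^+ 2 =
  p%:R ^+ 2 * (phi ^+ 3 + a%:P * phi * psi ^+ 4 + b%:P * psi ^+ 6).
Proof. by apply: (divpoly_der_square _ _ charS); [|lia]. Qed.

Let map_rho : mp rho = 0.
Proof.
have /(congr1 mp) := rho_square.
rewrite map_p2 rmorphM rmorphXn /= map_f => /eqP.
rewrite mulf_eq0 expf_eq0 /=.
have [_ hl] := lead_cubic (pi a) (pi b).
have /negPf -> : f' != 0.
  by apply: contra_eqN hl => /eqP ->; rewrite coef0 eq_sym oner_neq0.
by move=> /eqP.
Qed.

Let rho_dvd : exists w, rho = p%:R * w.
Proof.
have [|A [B [-> _ sB]]] := @poly_split_dvd S p%:R 0 _ rho (leqnn _).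
  by move=> i _; apply: ker_pi; rewrite -coef_map map_rho coef0.
exists A; have -> : B = 0 by apply/eqP; rewrite -size_poly_leq0.
by rewrite addr0 polyC_natr.
Qed.

Let der_map : (mp phi)^`() * q = 2 * mp phi * q^`().
Proof.
have := map_rho; rewrite /rho; move: phi psi => u t /eqP.
by rewrite rmorphB !rmorphM rmorph_nat /= !deriv_map subr_eq0 => /eqP.
Qed.

Let lead_map u n c : lead_at u n c -> lead_at (mp u) n (pi c).
Proof.
by case=> su <-; split; [apply: leq_trans (size_poly _ _) su|rewrite coef_map].
Qed.

Let phi_coef j : (P - k <= j < P)%N -> (mp phi)`_j = 0.
Proof.
move=> hj; apply: (der_quotient_coef charS' toda_q q_neq0 _ der_map); rewrite PE //.
by have := lead_map lead_phi; rewrite rmorph1.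
Qed.

(** The degree of q is a multiple of p and at most d = k p + k, hence at most k p = M. *)
Let size_q : (size q <= M.+1)%N.
Proof.
have /dvdnP[i ei] := dvdn_toda_size charS' toda_q q_neq0.
have hs : (size q <= d.+1)%N by case: (lead_map lead_psi).
move: ei hs; move: (size q) => m ei hs.
have : (i <= k)%N by nia.
by nia.
Qed.

Lemma psi_split : exists A B, [/\ psi = p%:R%:P * A + B, (size A <= d.+1)%N & (size B <= M.+1)%N].
Proof.
apply: poly_split_dvd; first by case: lead_psi.
move=> i Mi; apply: ker_pi; rewrite -coef_map nth_default //.
exact: leq_trans size_q Mi.
Qed.

Lemma phi_split : exists C E, [/\ phi = 'X^P + p%:R%:P * C + E, (size C <= P)%N
  & (size E <= P - k)%N].
Proof.
have [sphi cphi] := lead_phi.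
have [||C [E [e sC sE]]] := @poly_split_dvd S p%:R (P - k) P (phi - 'X^P).
- apply/leq_sizeP => j; rewrite leq_eqVlt => /orP[/eqP <-|nj].
    by rewrite coefB cphi coefXn eqxx subrr.
  by rewrite coefB coefXn gtn_eqF // subr0 nth_default // (leq_trans sphi).
- move=> i hi; apply: ker_pi.
  case: (ltngtP i P) => iP.
  + by rewrite coefB coefXn ltn_eqF // subr0 -coef_map phi_coef // hi.
  + by rewrite coefB coefXn gtn_eqF // subr0 nth_default ?rmorph0 // (leq_trans sphi).
  + by rewrite coefB iP cphi coefXn eqxx subrr rmorph0.
by exists C, E; split=> //; rewrite -addrA -e addrC subrK.
Qed.

(** Precision p^2 is needed because rho is divided by p afterwards. The products p C B and E psi
    stay below degree P + M, so only x^P psi matters. *)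
Let coef_Xrho N : (P + M <= N)%N -> exists z,
  ('X * rho)`_N = p%:R ^+ 2 * z - 2 * (N - P)%:R * psi`_(N - P).
Proof.
move=> hN; have [A [B [eA sA sB]]] := psi_split.
have [C [E [eC sC sE]]] := phi_split.
have -> : 'X * rho = euler phi * psi - 2 * phi * euler psi.
  by rewrite /rho /euler; ring.
set low := p%:R%:P * (euler C * B) + euler E * psi - 2%:R%:P * (p%:R%:P * (C * euler B) + E * euler psi).
set z := euler C * A - 2%:R%:P * (C * euler A).
have -> : euler phi * psi - 2 * phi * euler psi =
   P%:R%:P * ('X^P * psi) - 2%:R%:P * ('X^P * euler psi) + (p%:R ^+ 2)%:P * z + low.
  have e1 : euler psi = p%:R%:P * euler A + euler B.
    by rewrite eA /euler derivD deriv_mulC; ring.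
  have e2 : euler phi = P%:R%:P * 'X^P + p%:R%:P * euler C + euler E.
    rewrite eC /euler !derivD deriv_mulC derivXn polyC_natr -mulr_natl addn1 /= !mulrDr.
    by rewrite exprS; ring.
  have -> : (p%:R ^+ 2)%:P = p%:R%:P ^+ 2 :> {poly S} by rewrite rmorphXn.
  have h2 : 2%:R%:P = 2 :> {poly S} by rewrite polyC_natr.
  rewrite /low /z h2 e2 eC; move: (euler psi) psi e1 eA => t u -> ->.
  by ring.
have slow : (size low <= P + M)%N.
  have [spsi _] := lead_psi; rewrite /low.
  apply: size_sub_le; first apply: size_add_le.
  - apply: size_Cmul_le; apply: size_mul_le (size_euler_le sC) sB _; lia.
  - by apply: size_mul_le (size_euler_le sE) spsi _; lia.
  - apply: size_Cmul_le; apply: size_add_le.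
      by apply: size_Cmul_le; apply: size_mul_le sC (size_euler_le sB) _; lia.
    by apply: size_mul_le sE (size_euler_le spsi) _; lia.
(* The second summand absorbs the term from [euler] applied to x^P, whose factor P is p^2. *)
exists (z`_N + psi`_(N - P)).
have PN : (N < P)%N = false by lia.
rewrite 2!coefD coefB !coefCM !coefXnM PN coef_euler (nth_default _ (leq_trans slow hN)).
by rewrite -PE natrX; ring.
Qed.

Let sqrt_phi_cube : exists W, [/\ f * W ^+ 2 = 'X^2 * (phi ^+ 3 + a%:P * phi * psi ^+ 4 + b%:P * psi ^+ 6),
  lead_at (mp W) (P + d) 1 & (mp W)`_(P + M) = pi psi`_M].
Proof.
have [w ew] := rho_dvd.
have cW j : ('X * rho)`_j = p%:R * ('X * w)`_j.
  by rewrite ew -polyC_natr mulrCA coefCM.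
have sW : (size ('X * w)%R <= (P + d).+1)%N.
  apply/leq_sizeP => j hj; apply: (mulfI p_neq0); rewrite mulr0 -cW.
  have -> : 'X * rho = euler phi * psi - 2 * (phi * euler psi).
    by rewrite /rho /euler; ring.
  have h1 := lead_atM (lead_at_euler lead_phi) lead_psi.
  have h2 := lead_atM (lead_at_nat S 2) (lead_atM lead_phi (lead_at_euler lead_psi)).
  have [h3 _] := lead_atB h1 h2.
  by rewrite nth_default // (leq_trans h3).
exists ('X * w); split.
- have := rho_square; rewrite ew => H.
  have p2 : p%:R ^+ 2 != 0 :> {poly S}.
    by rewrite -polyC_natr expf_neq0 // polyC_eq0.
  by apply: (mulfI p2); rewrite [RHS]mulrCA -H; ring.
- split; first exact: leq_trans (size_poly _ _) sW.
  rewrite coef_map; have [|z hz] := @coef_Xrho (P + d); first lia.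
  have {hz} := hz; rewrite cW addKn; have [_ ->] := lead_psi.
  (* The top coefficient of psi is p, so after division by p there remains -2d = 1 - p^2, which is 1
     modulo p. *)
  have -> : p%:R ^+ 2 * z - 2 * d%:R * p%:R = p%:R * (p%:R * z - 2 * d%:R) by ring.
  move/(mulfI p_neq0) ->; rewrite raddfB /= !rmorphM pi_p mul0r !rmorph_nat sub0r.
  apply/eqP; rewrite eq_sym -subr_eq0 opprK -natrM addrC natr1.
  by rewrite -(dvdn_pcharf charS'); apply/dvdnP; exists p; nia.
- rewrite coef_map; have [|z hz] := @coef_Xrho (P + M); first lia.
  have {hz} := hz; rewrite cW addKn.
  (* Here the factor p to cancel comes from M, and -2k = 1 - p is 1 modulo p. *)
  have -> : M%:R = p%:R * k%:R :> S by rewrite -natrM; congr _%:R; nia.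
  have -> : p%:R ^+ 2 * z - 2 * (p%:R * k%:R) * psi`_M =
    p%:R * (p%:R * z - 2 * k%:R * psi`_M) by ring.
  move/(mulfI p_neq0) ->; rewrite raddfB /= !rmorphM pi_p mul0r !rmorph_nat sub0r.
  apply/eqP; rewrite eq_sym -subr_eq0 opprK -{1}[pi _]mul1r -mulrDl -natrM addrC natr1.
  by have := pcharf0 charS'; rewrite addn1 => ->; rewrite mul0r.
Qed.

Let two_neq0 : 2 != 0 :> S'.
Proof.
rewrite -(dvdn_pcharf charS'); apply/negP => /dvdn_leq; lia.
Qed.

Let charP' : p \in [pchar {poly S'}].
Proof.
by rewrite inE (pcharf_prime charS') /= -polyC_natr pcharf0.
Qed.

Let cubic_exp_char : f' ^+ p = 'X^(3 * p) + (pi a ^+ p)%:P * 'X^p + (pi b ^+ p)%:P.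
Proof.
have pn : [pchar {poly S'}].-nat p.
  by rewrite pnatE ?(pcharf_prime charS').
rewrite /curve_cubic -mul_polyC !exprDn_pchar // -exprM exprMn.
by rewrite !rmorphXn.
Qed.

Theorem cubic_coef_divpoly_coef : pi (f ^+ k)`_(2 * k) = pi psi`_M.
Proof.
have [W [fW lW <-]] := sqrt_phi_cube.
have {fW} : f' * mp W ^+ 2 = 'X^2 *
    (mp phi ^+ 3 + (pi a)%:P * mp phi * q ^+ 4 + (pi b)%:P * q ^+ 6).
  move: (fW) => /(congr1 mp); clear fW lW; move: map_f.
  move: f phi psi W => F u v w <-.
  by rewrite !(rmorphD, rmorphXn, rmorphM) /= map_polyX !map_polyC.
move: (mp W) lW => V lV fV.
(* This exponent gives [G] the degree P + d of W, as c + 3k = P + d; also P + M = c + 2k, so the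
   coefficient sought is that of x^(2k) in f^k. *)
pose c := (6 * (k * k) + 3 * k + 1)%N.
pose G := 'X^c * f' ^+ k.
have lG : lead_at G (P + d) 1.
  have lX : lead_at ('X^c : {poly S'}) c 1 by split; rewrite ?size_polyXn ?coefXn ?eqxx.
  apply: lead_at_cast (lead_atM lX (lead_at_exp k (lead_cubic _ _))) _ _.
    by rewrite /c; lia.
  by rewrite expr1n mul1r.
have fG : f' * G ^+ 2 = 'X^(3 * P + 2) + 'X^(2 * c) * ((pi a ^+ p)%:P * 'X^p + (pi b ^+ p)%:P).
  have -> : f' * G ^+ 2 = 'X^(2 * c) * f' ^+ p.
    by rewrite /G exprMn -!exprM addn1 exprS mulrCA (mulnC c) (mulnC k).
  rewrite cubic_exp_char -addrA mulrDr -exprD; congr ('X^_ + _).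
  by rewrite /c; lia.
have [E' [eE sE]] : exists E, mp phi = 'X^P + E /\ (size E <= P - k)%N.
  have [sphi cphi] := lead_map lead_phi.
  exists (mp phi - 'X^P); split; first by rewrite [RHS]addrC subrK.
  apply/leq_sizeP => j hj; rewrite coefB coefXn.
  case: (ltngtP j P) => jP.
  - by rewrite subr0 phi_coef // hj.
  - by rewrite subr0 nth_default // (leq_trans sphi).
  - by rewrite jP cphi rmorph1 subrr.
have [sphi _] := lead_map lead_phi.
(* Both products are x^(3P+2) plus terms of lower order; the bound M on the degree of q, rather than
   d, makes those with q small enough. *)
have sdiff : (size (f' * V ^+ 2 - f' * G ^+ 2)%R <= 3 * P + 2 - k)%N.
  have -> : f' * V ^+ 2 - f' * G ^+ 2 =
     'X^2 * (E' * (mp phi ^+ 2 + 'X^P * (mp phi + 'X^P))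
     + ((pi a)%:P * (mp phi * q ^+ 4) + (pi b)%:P * q ^+ 6))
     - ('X^(2 * c) * ((pi a ^+ p)%:P * 'X^p + (pi b ^+ p)%:P)).
    have e3 : 'X^(3 * P + 2) = 'X^2 * ('X^P) ^+ 3 :> {poly S'}.
      by rewrite -exprM -exprD; congr ('X^_); lia.
    rewrite fV fG e3 eE; move: ('X^P) ('X^(2 * c)) ('X^p) => Y Z X; ring.
  have sX n : (size ('X^n : {poly S'}) <= n.+1)%N by rewrite size_polyXn.
  have sq4 := size_exp_le 4 size_q; have sq6 := size_exp_le 6 size_q.
  apply: size_sub_le.
    apply: (size_mul_le (n := 3 * P - k) (sX 2)); last lia.
    apply: size_add_le; last apply: size_add_le.
    - apply: (size_mul_le (n := (2 * P).+1) sE); last lia.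
      apply: size_add_le; first by apply: leq_trans (size_exp_le 2 sphi) _; lia.
      apply: (size_mul_le (sX P) (n := P.+1)); last lia.
      exact: size_add_le.
    - by apply: size_Cmul_le; apply: size_mul_le sphi sq4 _; lia.
    - by apply: size_Cmul_le; apply: leq_trans sq6 _; lia.
  apply: (size_mul_le (sX (2 * c)%N) (n := p.+1)); last by rewrite /c; lia.
  apply: size_add_le; first exact: size_Cmul_le.
  by rewrite (leq_trans (size_polyC_leq1 _)).
(* The difference factors as f (V + G) (V - G), and V + G has exact degree P + d with leading
   coefficient 2, so V - G has degree below P + M. *)
have VG : (V - G)`_(P + M) = 0.
  have [->|VG0] := eqVneq (V - G) 0; first by rewrite coef0.
  have lVG : lead_at (V + G) (P + d) 2 by apply: lead_atD.
  have sVG := lead_at_sizeE lVG two_neq0.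
  have sf := lead_at_sizeE (lead_cubic (pi a) (pi b)) (oner_neq0 _).
  have VpG0 : V + G != 0 by rewrite -size_poly_gt0 sVG.
  have f0 : f' != 0 by rewrite -size_poly_gt0 sf.
  move: sdiff; have -> : f' * V ^+ 2 - f' * G ^+ 2 = f' * (V + G) * (V - G) by ring.
  rewrite size_mul ?mulf_neq0 // size_mul // sf sVG => hs.
  by rewrite nth_default //; move: hs; move: (size _) => n; lia.
have -> : V`_(P + M) = G`_(P + M).
  by apply/eqP; rewrite -subr_eq0 -coefB VG.
rewrite /G coefXnM; have -> : (P + M < c)%N = false by rewrite /c; lia.
have -> : (P + M - c = 2 * k)%N by rewrite /c; lia.
by rewrite -coef_map rmorphXn /= map_f.
Qed.

End Reduction.

(** * Application to Z[A,B] and its reduction modulo p *)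

Lemma pchar_ZAB : [pchar ZAB] =i pred0.
Proof.
apply/pcharf0P => n; rewrite -mpolyC_nat mpolyC_eq0.
by have /pcharf0P -> := Num.Theory.pchar_num int.
Qed.

Lemma map_mpoly_Fp_ker p (u : ZAB) : prime p ->
  map_mpoly (intr : int -> 'F_p) u = 0 -> exists v, u = p%:R * v.
Proof.
move=> pp u0; exists (\sum_(m <- msupp u) (u@_m %/ p)%Z *: 'X_[m]).
rewrite {1}[u]mpolyE mulr_sumr; apply: eq_bigr => m _.
rewrite -mpolyC_nat mul_mpolyC scalerA natz mulrC divzK //.
by rewrite (dvdz_pcharf (pchar_Fp pp)) -mcoeff_map_mpoly u0 mcoeff0.
Qed.

Lemma division_polynomialE p : odd p -> division_polynomial p = divpoly indA indB p.
Proof.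
move=> o; rewrite /division_polynomial (division_polynomials_uniq psiP curve_dpolyP).
by rewrite /curve_dpoly /lift_dpoly o mul1r qpolyCE coefC.
Qed.

Theorem mainTheorem1 (p : nat) (hp : prime p) (hp3 : (3 <= p)%N) :
  exists d : {mpoly int[2]}, hasse_coef p - ell p = p%:R * d.
Proof.
have op : odd p by case: (even_prime hp) => // p2; rewrite p2 in hp3.
have [k ek] : exists k, p = (2 * k + 1)%N by exists p./2; lia.
apply: (map_mpoly_Fp_ker hp); apply/eqP; rewrite rmorphB subr_eq0; apply/eqP.
rewrite /hasse_coef /ell (division_polynomialE op).
have -> : ((p - 1) %/ 2 = k)%N by lia.
have -> : (p - 1 = 2 * k)%N by lia.
have -> : (p * (2 * k) %/ 2 = 2 * (k * k) + k)%N by rewrite mulnCA mulKn // ek; lia.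
have charFp : p \in [pchar {mpoly 'F_p[2]}].
  by rewrite inE hp /= -mpolyC_nat (pcharf0 (pchar_Fp hp)) mpolyC0.
(* The specialization A = 1, B = 0 required by the special value argument. *)
pose v (i : 'I_2) : int := (i == ord0)%:R.
have hA : meval v indA = 1 by rewrite /indA mevalXU.
have hB : meval v indB = 0 by rewrite /indB mevalXU.
have ker (u : ZAB) : map_mpoly (intr : int -> 'F_p) u = 0 -> exists w, u = p%:R * w.
  exact: map_mpoly_Fp_ker.
have := @cubic_coef_divpoly_coef ZAB {mpoly 'F_p[2]} (map_mpoly intr) k pchar_ZAB.
by rewrite -ek => /(_ charFp ker _ _ _ hA hB).
Qed.
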